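(* Let $d\ge 2$, $k\ge 1$, let $T=(1,2,\ldots,d-1,d^k,d-1,\ldots,2,1)$ ($d$ occurring $k$ times), and assume $\operatorname{char}\mathsf k=0$. Then there is a one-to-one correspondence between the CIJT partitions $P_\ell$ of diagonal lengths $T$ and the $2^d$ (when $k>1$) or $2^{d-1}$ (when $k=1$) subsets of the active Hessians for $T$ that vanish at $\ell$. In particular, let $P$ be a partition of diagonal lengths $T$, let $n$ be an integer with $0\le n\le d$ if $k\ge2$ and $0\le n\le d-1$ if $k=1$, and let $n=n_1+\cdots+n_c$ be an ordered partition of $n$ into positive integers (empty, $c=0$, if $n=0$). The following are equivalent: (i) $P=P_{\ell,A}$ for some nonzero linear form $\ell\in R$ and some graded Artinian complete intersection algebra $A=R/\operatorname{Ann}F$ such that $h^{\,n_1+\cdots+n_i-1}_\ell(F)\ne0$ for each $i\in[1,c]$ and all the remaining active Hessians are zero at $\ell$; (ii) $P=\big(p_1^{n_1},\ldots,p_c^{n_c},(d-n)^{d-n+k-1}\big)$, where $p_i=k-1+2d-n_i-2(n_1+\cdots+n_{i-1})$ for $1\le i\le c$ (the last block is absent if $n=d$).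
   Context: $\mathsf k$ is an infinite field, $R=\mathsf k[x,y]$ with the standard grading, $j=2d+k-3$. Here $T_i=i+1$ for $0\le i\le d-1$, $T_i=d$ for $d-1\le i\le d+k-2$, $T_i=j+1-i$ for $d+k-2\le i\le j$. The notation $p^{m}$ in a partition means the part $p$ repeated $m$ times. The diagonal lengths of a partition $P=(p_1\ge\cdots\ge p_s>0)$ are $(t_0,t_1,\ldots)$ with $t_i=\#\{(r,c): 1\le r\le s,\ 1\le c\le p_r,\ r+c-2=i\}$. For a graded Artinian quotient $A=R/I$ and a nonzero linear form $\ell$, the Jordan type $P_{\ell,A}$ is the partition of Jordan block sizes of multiplication by $\ell$ on $A$. A partition $P$ of diagonal lengths $T$ is a CIJT partition if $P=P_{\ell,A}$ for some graded Artinian complete intersection $A=R/I$ and some nonzero linear form $\ell$. $R$ acts on $\mathcal E=\mathsf k[X,Y]$ by differentiation ($x=\partial_X$, $y=\partial_Y$), written $f\circ F$. Every graded Artinian complete intersection quotient of $R$ of socle degree $j$ is $A=R/\operatorname{Ann}F$ with $F\in\mathcal E_j$ and $\operatorname{Ann}F=\{f\in R: f\circ F=0\}$. For $0\le i\le d-1$, given a basis $(\alpha_1,\ldots,\alpha_{i+1})$ of $A_i$, the $i$-th Hessian is $h^i(F)=\det[\alpha_u\alpha_v\circ F]_{u,v}$, well defined up to a nonzero scalar; for $\ell=ax+by$, $h^i_\ell(F)$ is its value at $(X,Y)=(a,b)$ (nonzero iff multiplication by $\ell^{j-2i}:A_i\to A_{j-i}$ is an isomorphism). The active Hessians for $T$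 are $h^0,\ldots,h^{d-2}$, and also $h^{d-1}$ when $k\ge2$. The correspondence in the first paragraph assigns to a CIJT partition $P=P_{\ell,A}$ the subset of active Hessians vanishing at $\ell$. *)

(* Defs.v *)
From HB Require Import structures.
From mathcomp Require Import all_boot all_order all_algebra.
From mathcomp Require Export mpoly.

Set Implicit Arguments.
Unset Strict Implicit.
Unset Printing Implicit Defensive.

Import GRing.Theory.
Local Open Scope ring_scope.

Definition is_partition (P : seq nat) : bool :=
  sorted geq P && all (fun p => 0 < p)%N P.

(* The cells are indexed from 0, so cell (r, c) lies on diagonal r + c. *)
Definition diag_length (P : seq nat) (i : nat) : nat :=
  (\sum_(r < size P) \sum_(c < nth 0%N P r) (r + c == i))%N.

Definition socle_deg (d k : nat) : nat := (2 * d + k - 3)%N.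

(* T = (1, 2, ..., d-1, d^k, d-1, ..., 2, 1); the truncated subtraction makes
   T_i = 0 for i > socle_deg d k. *)
Definition T_seq (d k i : nat) : nat :=
  if (i < d)%N then i.+1
  else if (i <= d + k - 2)%N then d
  else ((socle_deg d k).+1 - i)%N.

Definition has_diag_lengths (P : seq nat) (d k : nat) : Prop :=
  forall i, diag_length P i = T_seq d k i.

(* The active Hessians are the h^i with i < nactive d k. *)
Definition nactive (d k : nat) : nat := if (2 <= k)%N then d else d.-1.

Section Quotients.
Variable K : fieldType.
Local Notation R := {mpoly K[2]}.

(* (e_t) is a family in V whose classes form a K-basis of (V + I) / I. *)
Definition basis_mod (I V : R -> Prop) (J : finType) (e : J -> R) : Prop :=
  [/\ forall t, V (e t),
      forall c : J -> K, I (\sum_t c t *: e t) -> forall t, c t = 0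
    & forall f, V f -> exists c : J -> K, I (f - \sum_t c t *: e t)].

Definition whole : R -> Prop := fun _ => True.

Definition forms (i : nat) : R -> Prop := fun f => f \is i.-homog.

Definition artinian (I : R -> Prop) : Prop :=
  exists (m : nat) (e : 'I_m -> R), basis_mod I whole e.

Definition ideal2 (f g : R) : R -> Prop :=
  fun h => exists u v : R, h = u * f + v * g.

Definition regular_sequence2 (f g : R) : Prop :=
  [/\ forall h, h * f = 0 -> h = 0,
      forall h, (exists q, h * g = q * f) -> exists q, h = q * f
    & ~ ideal2 f g 1].

Definition graded_artinian_ci (I : R -> Prop) : Prop :=
  artinian I /\
  exists (p q : nat) (f g : R),
    [/\ f \is p.-homog, g \is q.-homog, regular_sequence2 f g
      & forall h, I h <-> ideal2 f g h].

Definition linear_form (l : R) : Prop := l \is 1.-homog /\ l != 0.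

(* P is the partition of Jordan block sizes of the (nilpotent) multiplication
   by l on R / I: there are z_0, ..., z_{s-1} whose strings
   z_r, l z_r, ..., l^(p_r - 1) z_r, with l^(p_r) z_r = 0, together form a
   basis of R / I. *)
Definition jordan_type (I : R -> Prop) (l : R) (P : seq nat) : Prop :=
  is_partition P /\
  exists z : 'I_(size P) -> R,
    basis_mod I whole
      (fun t : {r : 'I_(size P) & 'I_(nth 0%N P r)} =>
         l ^+ tagged t * z (tag t)) /\
    forall r : 'I_(size P), I (l ^+ nth 0%N P r * z r).

Definition CIJT (d k : nat) (P : seq nat) : Prop :=
  [/\ is_partition P, has_diag_lengths P d k
    & exists (I : R -> Prop) (l : R),
        [/\ graded_artinian_ci I, linear_form l & jordan_type I l P]].

(* f o F, where the variables of f act on F as partial derivatives. *)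
Definition apply_diff (f F : R) : R :=
  \sum_(m <- msupp f) f@_m *: F^`M[m].

Definition Ann (F : R) : R -> Prop := fun f => apply_diff f F = 0.

Definition hessian (n : nat) (al : 'I_n -> R) (F : R) : R :=
  \det (\matrix_(u < n, v < n) apply_diff (al u * al v) F).

(* (a, b) for l = a x + b y. *)
Definition coefs (l : R) : 'I_2 -> K := fun i => l@_U_(i).

(* h^i_l(F) = 0.  The Hessian is defined by a basis of A_i, A = R / Ann F, only
   up to a nonzero scalar; hess_vanishesP below shows that every basis gives
   the same condition. *)
Definition hess_vanishes (F : R) (i : nat) (l : R) : Prop :=
  forall al : 'I_i.+1 -> R, basis_mod (Ann F) (forms i) al ->
    (hessian al F).@[coefs l] = 0.

Lemma apply_diff_bound b f F : (msize f <= b)%N ->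
  apply_diff f F = \sum_(m : 'X_{1..2 < b}) f@_m *: F^`M[m].
Proof.
move=> lefb; pose I : subFinType _ := 'X_{1..2 < b}.
rewrite /apply_diff (ssrcomplements.big_mksub I) ?msupp_uniq //=; last first.
  by move=> m /msize_mdeg_lt /leq_trans; apply.
by rewrite big_rmcond //= => m /memN_msupp_eq0 ->; rewrite scale0r.
Qed.

Lemma apply_diffD f g F :
  apply_diff (f + g) F = apply_diff f F + apply_diff g F.
Proof.
pose b := maxn (msize (f + g)) (maxn (msize f) (msize g)).
rewrite !(@apply_diff_bound b) ?leq_max ?leqnn ?orbT //.
by rewrite -big_split /=; apply: eq_bigr => m _; rewrite mcoeffD scalerDl.
Qed.

Lemma apply_diffZ c f F : apply_diff (c *: f) F = c *: apply_diff f F.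
Proof.
pose b := maxn (msize (c *: f)) (msize f).
rewrite !(@apply_diff_bound b) ?leq_max ?leqnn ?orbT // scaler_sumr.
by apply: eq_bigr => m _; rewrite mcoeffZ scalerA.
Qed.

Lemma apply_diff0 F : apply_diff 0 F = 0.
Proof. by rewrite /apply_diff msupp0 big_nil. Qed.

Lemma apply_diffX m F : apply_diff 'X_[m] F = F^`M[m].
Proof. by rewrite /apply_diff msuppX big_seq1 mcoeffX eqxx scale1r. Qed.

Lemma apply_diff_sum (J : Type) (s : seq J) (f : J -> R) F :
  apply_diff (\sum_(t <- s) f t) F = \sum_(t <- s) apply_diff (f t) F.
Proof.
by elim: s => [|t s IH]; rewrite ?big_nil ?apply_diff0 // !big_cons apply_diffD IH.
Qed.

Lemma apply_diff_r0 f : apply_diff f 0 = 0.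
Proof.
by rewrite /apply_diff big1 // => m _; rewrite raddf0 scaler0.
Qed.

Lemma apply_diffM f g F :
  apply_diff (f * g) F = apply_diff f (apply_diff g F).
Proof.
rewrite [f in LHS]mpolyE mulr_suml apply_diff_sum [RHS]/apply_diff.
apply: eq_bigr => m _; rewrite -scalerAl apply_diffZ; congr (_ *: _).
rewrite [g in LHS]mpolyE mulr_sumr apply_diff_sum [in RHS]/apply_diff raddf_sum.
apply: eq_bigr => m' _; rewrite -scalerAr apply_diffZ /= mderivmZ.
by rewrite -mpolyXD apply_diffX addmC mderivmDm.
Qed.

Lemma hessian_basis_indep F i l (al be : 'I_i.+1 -> R) :
  basis_mod (Ann F) (forms i) al -> basis_mod (Ann F) (forms i) be ->
  (hessian al F).@[coefs l] = 0 -> (hessian be F).@[coefs l] = 0.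
Proof.
move=> [_ _ spa] [be_i _ _].
pose B f g : K := (apply_diff (f * g) F).@[coefs l].
have hE ga : (hessian ga F).@[coefs l] = \det (\matrix_(u, v) B (ga u) (ga v)).
  rewrite /hessian -det_map_mx; congr (\det _).
  by apply/matrixP => u v; rewrite !mxE.
have BC f g : B f g = B g f by rewrite /B mulrC.
have Bsum (c : 'I_i.+1 -> K) (f g : R) : Ann F (f - \sum_t c t *: al t) ->
    B f g = \sum_t c t * B (al t) g.
  move=> I0; rewrite -{1}[f](subrK (\sum_t c t *: al t)) /B mulrDl apply_diffD.
  rewrite [X in apply_diff X F + _]mulrC (apply_diffM g).
  move: I0; rewrite /Ann => ->; rewrite apply_diff_r0 add0r.
  rewrite mulr_suml apply_diff_sum raddf_sum /=; apply: eq_bigr => t _.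
  by rewrite -scalerAl apply_diffZ mevalZ.
have /fin_all_exists [M MP] : forall u, exists c : {ffun 'I_i.+1 -> K},
    Ann F (be u - \sum_t c t *: al t).
  move=> u; have [c cP] := spa _ (be_i u); exists (finfun c).
  by under eq_bigr do rewrite ffunE.
pose N := \matrix_(u < i.+1, t < i.+1) M u t.
rewrite !hE => h0.
have -> : \matrix_(u, v) B (be u) (be v) =
          N *m (\matrix_(u, v) B (al u) (al v)) *m N^T.
  apply/matrixP => u v; rewrite !mxE BC (Bsum _ _ _ (MP v)).
  apply: eq_bigr => t _; rewrite !mxE BC (Bsum _ _ _ (MP u)) mulrC.
  by congr (_ * _); apply: eq_bigr => s _; rewrite !mxE.
by rewrite !det_mulmx h0 mulr0 mul0r.
Qed.

Lemma hess_vanishesP F i l (al : 'I_i.+1 -> R) :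
  basis_mod (Ann F) (forms i) al ->
  hess_vanishes F i l <-> (hessian al F).@[coefs l] = 0.
Proof.
move=> bal; split=> [|h0 be bbe]; first exact.
exact: (hessian_basis_indep bal bbe h0).
Qed.

(* P = P_{l,A} with A = R / Ann F a graded Artinian complete intersection of
   socle degree j. *)
Definition realizes (j : nat) (F l : R) (P : seq nat) : Prop :=
  [/\ F \is j.-homog, graded_artinian_ci (Ann F), linear_form l
    & jordan_type (Ann F) l P].

End Quotients.

Definition psum (ns : seq nat) (i : nat) : nat := sumn (take i ns).

(* p_i for 1 <= i <= c, where n_i = nth 0 ns (i - 1). *)
Definition part_size (d k : nat) (ns : seq nat) (i : nat) : nat :=
  (k - 1 + 2 * d - nth 0 ns i.-1 - 2 * psum ns i.-1)%N.

(* (p_1^{n_1}, ..., p_c^{n_c}, (d - n)^{d - n + k - 1}), without the last block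
   if n = d. *)
Definition hess_partition (d k : nat) (ns : seq nat) : seq nat :=
  let n := sumn ns in
  flatten [seq nseq (nth 0%N ns i.-1) (part_size d k ns i)
          | i <- iota 1 (size ns)]
  ++ (if n == d then [::] else nseq (d - n + k - 1) (d - n)%N).

(* Main.v *)
From HB Require Import structures.
Require Import Defs.
From mathcomp Require Import all_boot all_order all_algebra.
From mathcomp Require Import mpoly zify ring.

Set Implicit Arguments.
Unset Strict Implicit.
Unset Printing Implicit Defensive.

(* Write A = R / Ann F and let phi(f) be the constant term of f o F, so that f is in
   Ann F iff phi (g f) = 0 for all g. In coordinates (l, m) put
   c_u = phi (l^(j-u) m^u). Everything is read off the Hankel matrix (c_(u+v)): its
   leading principal minors are, up to nonzero constants, the Hessians at l, and if
   s(r) is the largest n for which some Y = m^r + (multiples of l) of degree r is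
   orthogonal to the first n columns, then p_r = j + 1 - r - s(r) is the least p
   with l^p Y in Ann F for such a Y. The strings l^c Y_r with c < p_r form a basis
   of A, so P = (p_0, p_1, ...) is the Jordan type. The symmetry of the Hankel
   matrix makes s an involution, and p_r >= p_(r+1) means that s(r+1) >= s(r) - 1;
   hence s reverses the consecutive blocks of a composition of the number of parts.
   The partial sums of the composition are the b such that s preserves [0, b), that
   is, those with h^(b-1) nonzero at l. Diagonal lengths T allow exactly d or
   d + k - 1 parts.
   Conversely, a composition (n_1, ..., n_c) is realized by the ideal of the
   continuants h_c and l^p h_(c-1), where h_(m+1) = m^(n_(m+1)) h_m - l^e h_(m-1)
   with the exponents p, e making the degrees fit. *)

(** * Symmetric partitions *)

Section SymmetricPartitions.
Variable j : nat.

(* The string of length p_r that starts in degree r ends in degree j - s(r),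
   where s(r) = j + 1 - r - p_r, and s is an involution. *)
Definition symmetric_partition (P : seq nat) : Prop :=
  is_partition P /\ forall r, r < size P ->
    r + nth 0 P r <= j.+1 /\ nth 0 P (j.+1 - r - nth 0 P r) = nth 0 P r.

(* The involution s preserves [0, b). *)
Definition boundary (P : seq nat) (b : nat) : bool :=
  (b <= size P) && all (fun r => j.+1 < b + r + nth 0 P r) (iota 0 b).

Lemma boundaryP P b :
  reflect (b <= size P /\ forall r, r < b -> j.+1 < b + r + nth 0 P r) (boundary P b).
Proof.
apply: (iffP andP) => -[bs H]; split=> //.
  by move=> r rb; apply: (allP H); rewrite mem_iota.
by apply/allP => r; rewrite mem_iota add0n => /H.
Qed.

Section Fixed.
Variable P : seq nat.
Hypothesis symP : symmetric_partition P.

Lemma part_gt0 r : (r < size P) = (0 < nth 0 P r).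
Proof.
have [/andP[_ /allP pP] _] := symP.
have [rs|rs] := ltnP r (size P); first by rewrite (pP (nth 0 P r)) // mem_nth.
by rewrite nth_default.
Qed.

Lemma part_mono r r' : r <= r' -> nth 0 P r' <= nth 0 P r.
Proof.
have [/andP[sP _] _] := symP => rr'.
have [r's|r's] := ltnP r' (size P); last by rewrite nth_default.
move: rr'; rewrite leq_eqVlt => /orP[/eqP-> //|rr'].
have geq_tr : transitive geq by move=> a b c ba ac; apply: leq_trans ac ba.
by apply: (sorted_ltn_nth geq_tr 0 sP) => //; rewrite inE // (ltn_trans rr').
Qed.

(** [v] is s(r); it is again a row because the part there is positive. *)
Lemma dual_part r : r < size P -> exists v,
  [/\ v < size P, r + v + nth 0 P r = j.+1 & nth 0 P v = nth 0 P r].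
Proof.
move=> rs; have [_ /(_ r rs)[le eqp]] := symP.
exists (j.+1 - r - nth 0 P r); rewrite part_gt0 eqp -part_gt0; split=> //; lia.
Qed.

Lemma boundary0 : boundary P 0.
Proof. by apply/boundaryP. Qed.

Lemma boundary_size : boundary P (size P).
Proof.
apply/boundaryP; split=> // r /dual_part[v [vs E _]]; lia.
Qed.

(** As s preserves [0, b), it preserves the complement, so the last row goes to some v >= b. The two
    indices and a positive part add up to j + 1. *)
Lemma boundary_lt_size b : boundary P b -> b < size P -> b + size P <= j.+1.
Proof.
move=> /boundaryP[_ H] bs; have ls : (size P).-1 < size P by lia.
have [v [vs E pv]] := dual_part ls.
have [vb|vb] := ltnP v b; last by move: (ls); rewrite part_gt0; lia.
by have := H v vb; rewrite pv; lia.
Qed.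

(** Put v = s(b). It lies in [b, b') and has the same part as b, so by monotonicity the parts are
    constant on [b, v]. Then s reverses [b, v] and v + 1 is a boundary, which forces v + 1 = b'. *)
Lemma boundary_block b b' : boundary P b -> boundary P b' -> b < b' ->
  (forall c, b < c < b' -> ~~ boundary P c) ->
  forall r, b <= r < b' -> r + nth 0 P r <= j.+1 /\ nth 0 P r + b + b' = j.+2.
Proof.
move=> /boundaryP[bs Hb] /boundaryP[b's Hb'] bb' no.
have bs' : b < size P by apply: leq_trans b's.
have [v [vs E pv]] := dual_part bs'.
have bv : b <= v by rewrite leqNgt; apply/negP => /Hb; rewrite pv; lia.
have vb' : v < b' by have := Hb' b bb'; lia.
have pr r : b <= r <= v -> nth 0 P r = nth 0 P b.
  by case/andP=> /part_mono br /part_mono rv; apply/eqP; rewrite eqn_leq br -pv.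
have vE : v.+1 = b'.
  apply/eqP; rewrite eqn_leq vb' leqNgt; apply/negP => lt.
  have /negP[] : ~~ boundary P v.+1 by apply: no; rewrite ltnS bv.
  apply/boundaryP; split=> // r rv; have [rb|br] := ltnP r b.
    by have := Hb r rb; lia.
  by rewrite pr ?br // ; lia.
move=> r /andP[br rb']; have rs : r < size P by apply: leq_trans b's.
have [_ /(_ r rs)[le _]] := symP; split=> //.
by rewrite pr; lia.
Qed.

(** Row r meets diagonal i iff r < i + 1 and s(r) < j + 1 - i. The two conditions never fail
    together, since r + s(r) <= j, so inclusion-exclusion applies; the involution counts the rows
    that satisfy the second one. *)
Lemma diag_length_sym i :
  diag_length P i + size P = minn (size P) i.+1 + minn (size P) (j.+1 - i).
Proof.
pose s (r : 'I_(size P)) : 'I_(size P) :=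
  insubd r (j.+1 - r - nth 0 P r).
have sE (r : 'I_(size P)) : r + s r + nth 0 P r = j.+1 /\ nth 0 P (s r) = nth 0 P r.
  have [v [vs E pv]] := dual_part (ltn_ord r).
  rewrite /s insubdK; last by rewrite (_ : _ - _ = v) //; lia.
  by rewrite (_ : _ - _ = v) //; lia.
have sK : involutive s.
  move=> r; apply: val_inj => /=; have [E1 E2] := sE r.
  by have [E3 E4] := sE (s r); move: E3; rewrite E2; lia.
have cnt m : \sum_(r < size P) (r < m : nat) = minn (size P) m.
  elim: (size P) => [|n IH]; first by rewrite big_ord0 min0n.
  by rewrite big_ord_recr /= IH; lia.
have -> : diag_length P i = \sum_(r < size P) ((r < i.+1) && (s r < j.+1 - i) : nat).
  apply: eq_bigr => r _; have [E _] := sE r.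
  transitivity (\sum_(c < nth 0 P r) ((r <= i) && (c == i - r :> nat) : nat)).
    by apply: eq_bigr => c _; congr nat_of_bool; lia.
  have -> : (r < i.+1) && (s r < j.+1 - i) = (r <= i) && (i - r < nth 0 P r) by lia.
  case: (r <= i) => /=; last by rewrite big1.
  elim: (nth 0 P r) => [|n IH]; first by rewrite big_ord0.
  by rewrite big_ord_recr /= IH; lia.
have sE1 : size P = \sum_(r < size P) 1 by rewrite sum1_card card_ord.
rewrite [X in _ + X = _]sE1 -big_split /=.
rewrite -(cnt i.+1) -(cnt (j.+1 - i)) [X in _ = _ + X](reindex_inj (inv_inj sK)).
rewrite -big_split /=; apply: eq_bigr => r _.
have [E _] := sE r; have := ltn_ord r; rewrite part_gt0.
by case: ltnP; case: ltnP => /=; lia.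
Qed.

End Fixed.

(* The partition whose involution s reverses consecutive blocks of sizes ns, from
   row b on. *)
Fixpoint layered (b : nat) (ns : seq nat) : seq nat :=
  if ns is n :: ns' then nseq n (j.+2 - 2 * b - n) ++ layered (b + n) ns' else [::].

Lemma layered_rcons b ns n : layered b (rcons ns n) =
  layered b ns ++ nseq n (j.+2 - 2 * (b + sumn ns) - n).
Proof.
elim: ns b => [|n' ns IH] b /=; first by rewrite cats0 addn0.
by rewrite IH catA addnA.
Qed.

(** [scanl] omits its starting value, so only the nonempty partial sums are listed. *)
Lemma mem_scanl_addn b b' ns : b' \in scanl addn b ns <->
  exists2 i, 0 < i <= size ns & b' = b + sumn (take i ns).
Proof.
elim: ns b => [|n ns IH] b /=; first by split=> // -[i]; lia.
rewrite inE; split.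
  case/orP=> [/eqP->|/IH[i hi ->]]; first by exists 1; rewrite //= take0 addn0.
  by exists i.+1 => /=; [lia | rewrite addnA].
case=> -[|[|i]] // hi E; first by rewrite E /= take0 addn0 eqxx.
by apply/orP; right; apply/IH; exists i.+1; [lia | rewrite E /= addnA].
Qed.

Lemma scanl_addn_rcons b ns n :
  scanl addn b (rcons ns n) = rcons (scanl addn b ns) (b + sumn ns + n).
Proof.
by elim: ns b => [|n' ns IH] b /=; rewrite ?addn0 // IH addnA.
Qed.

Lemma scanl_addn_ge b b' ns : b' \in scanl addn b ns -> b <= b'.
Proof. by case/mem_scanl_addn => i _ ->; rewrite leq_addr. Qed.

(** Induction over the blocks: between the boundaries b and b + n, [boundary_block] gives every part
    the value j + 2 - 2 b - n. *)
Lemma drop_layered P b ns : symmetric_partition P ->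
  all (fun n => 0 < n) ns -> boundary P b -> b + sumn ns = size P ->
  (forall b', b < b' <= size P -> boundary P b' = (b' \in scanl addn b ns)) ->
  drop b P = layered b ns.
Proof.
move=> symP; elim: ns b => [|n ns IH] b /=.
  by move=> _ _; rewrite addn0 => -> _; rewrite drop_size.
case/andP=> n0 pos bb E H.
have bn : boundary P (b + n) by rewrite H ?mem_head //; lia.
have bbn : b < b + n by lia.
have no c : b < c < b + n -> ~~ boundary P c.
  move=> hc; rewrite H; last by lia.
  rewrite inE negb_or; apply/andP; split; first by lia.
  by apply/negP => /scanl_addn_ge; lia.
rewrite -[LHS](cat_take_drop n) drop_drop [n + b]addnC (IH (b + n)) //; last 2 first.
- by rewrite -addnA.
- move=> b' hb'; rewrite H; last by lia.
  by rewrite inE (_ : b' == b + n = false) //; lia.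
congr (_ ++ _); apply: (@eq_from_nth _ 0).
  by rewrite size_nseq size_takel // size_drop; lia.
rewrite size_takel ?size_drop; last by lia.
move=> r rn; rewrite nth_take // nth_drop nth_nseq rn.
have br : b <= b + r < b + n by lia.
by have [_] := boundary_block symP bb bn bbn no br; lia.
Qed.

End SymmetricPartitions.

(** Subsets of (b, s] that contain s are the sets of partial sums of compositions of s - b. Strong
    induction splits off the least element above b. *)
Lemma composition_of_pred (D : pred nat) b s : b <= s -> D s -> exists ns,
  [/\ all (fun n => 0 < n) ns, b + sumn ns = s
    & forall b', b < b' <= s -> D b' = (b' \in scanl addn b ns)].
Proof.
move=> bs Ds; have [n] := ubnP (s - b); elim: n b bs => // n IH b bs sbn.
move: bs; rewrite leq_eqVlt => /orP[/eqP->|bs].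
  by exists [::]; split=> //=; [rewrite addn0 | move=> b'; lia].
have ex : exists m, D (b + m.+1).
  by exists (s - b).-1; rewrite prednK ?subn_gt0 // subnKC // ltnW.
case: (ex_minnP ex) => m Dm minm.
have bms : b + m.+1 <= s.
  have := minm (s - b).-1; rewrite prednK ?subn_gt0 // subnKC ?(ltnW bs) // => /(_ Ds).
  by lia.
have [|ns [pos E H]] := IH _ bms; first by lia.
exists (m.+1 :: ns); split=> //=; first by rewrite addnA.
move=> b' /andP[lt le]; rewrite inE.
have [lt'|gt'|->] := ltngtP b' (b + m.+1); last by rewrite Dm.
  rewrite /= [RHS](_ : _ = false); last by apply/negP => /scanl_addn_ge; lia.
  apply/negP => Db'; have := minm (b' - b).-1.
  rewrite prednK ?subn_gt0 // subnKC ?(ltnW lt) // => /(_ Db'); lia.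
by rewrite H // gt'.
Qed.

Lemma symmetric_partition_eq j P Q :
  symmetric_partition j P -> symmetric_partition j Q -> size P = size Q ->
  (forall b, 0 < b <= size P -> boundary j P b = boundary j Q b) -> P = Q.
Proof.
move=> symP symQ ePQ H.
have [ns [pos E HP]] := composition_of_pred (leq0n (size P)) (boundary_size symP).
rewrite -[P]drop0 -[Q]drop0 (drop_layered symP pos (boundary0 _ _) E HP).
rewrite (drop_layered symQ pos (boundary0 _ _)) -?ePQ // => b hb.
by rewrite -H // HP.
Qed.

(** Upper bounds on the first part of each block are enough to locate all boundaries. They are what
    membership of explicit forms in an ideal provides. *)
Lemma boundary_of_short_rows j P ns : symmetric_partition j P ->
  all (fun n => 0 < n) ns -> sumn ns = size P ->
  (forall m, m < size ns ->
     psum ns m + nth 0 P (psum ns m) + psum ns m.+1 <= j.+2) ->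
  forall b, 0 < b <= size P -> boundary j P b = (b \in scanl addn 0 ns).
Proof.
move=> symP pos E short.
have psS m : m < size ns -> psum ns m < psum ns m.+1.
  move=> ms; rewrite /psum (take_nth 0) // sumn_rcons -[X in X < _]addn0 ltn_add2l.
  by apply: (allP pos); rewrite mem_nth.
have ps_mono m m' : m <= m' -> psum ns m <= psum ns m'.
  move=> mm'; rewrite /psum -(subnKC mm') takeD sumn_cat; exact: leq_addr.
have between b : 0 < b <= size P ->
    exists m, [/\ m < size ns, psum ns m < b & b <= psum ns m.+1].
  move=> /andP[b0 bs]; have ex : exists m, b <= psum ns m.
    by exists (size ns); rewrite /psum take_size E.
  case: (ex_minnP ex) => -[|m] hm minm.
    by move: hm; rewrite /psum take0 /=; lia.
  have lt : psum ns m < b by rewrite ltnNge; apply/negP => /minm; lia.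
  exists m; split=> //; rewrite ltnNge; apply/negP => le.
  by move: lt; rewrite /psum take_oversize // E; lia.
(* The boundary condition at the row [psum ns m] contradicts [short] unless b is the right end of
   its block. So every boundary is a partial sum. *)
have bdE b : 0 < b <= size P -> boundary j P b -> exists2 m, m < size ns & b = psum ns m.+1.
  move=> hb /boundaryP[_ H]; have [m [ms lt le]] := between b hb; exists m => //.
  by have := H _ lt; have := short m ms; lia.
have bd m : m <= size ns -> boundary j P (psum ns m).
  elim: m => [|m IH] ms; first by rewrite /psum take0; apply: boundary0.
  have bm := IH (ltnW ms).
  have lts : psum ns m < size P.
    apply: (leq_trans (psS m ms)); rewrite -E -[X in _ <= sumn X](take_size ns).
    exact: ps_mono.
  have ex : exists b, (psum ns m < b <= size P) && boundary j P b.
    by exists (size P); rewrite lts leqnn boundary_size.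
  case: (ex_minnP ex) => b /andP[/andP[lt le] bb] minb.
  have [|i is_ bE] := bdE b _ bb; first by lia.
  have mi : m <= i.
    rewrite leqNgt; apply/negP => im; have := ps_mono i.+1 m im; lia.
  have Nmi := ps_mono _ _ mi; have lti := psS i is_.
  have no c : psum ns m < c < b -> ~~ boundary j P c.
    move=> hc; apply/negP => bc; have := minb c; rewrite bc andbT; lia.
  have hi : psum ns m <= psum ns i < b by lia.
  (* If the next boundary is b = [psum ns i.+1], the part at [psum ns i] is j + 2 - [psum ns m] - b;
     the bound [short] then leaves only i = m. *)
  have [_ pE] := boundary_block symP bm bb lt no hi.
  have sh := short i is_.
  have iE : psum ns i <= psum ns m by lia.
  have <- : i = m; last by rewrite -bE.
  apply/eqP; rewrite eqn_leq mi andbT leqNgt; apply/negP => im.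
  by have := psS m ms; have := ps_mono _ _ im; lia.
move=> b hb; apply/idP/idP => [bb|/mem_scanl_addn[i /andP[_ hi] ->]]; last exact: bd.
by have [m ms ->] := bdE b hb bb; apply/mem_scanl_addn; exists m.+1.
Qed.

(** * Partitions of diagonal lengths T and their active boundaries *)

Section SocleDegree.
Variables d k : nat.
Hypotheses (hd : 1 < d) (hk : 0 < k).
Local Notation j := (socle_deg d k).

Lemma T_seqE i : T_seq d k i = minn (minn i.+1 d) (j.+1 - i).
Proof.
rewrite /T_seq /socle_deg.
by case: ltnP => h; [|case: leqP => h']; lia.
Qed.

(** By [diag_length_sym] the diagonal lengths depend only on the number s of parts and on j'. Their
    plateau has height s or j + 2 - s, whichever is smaller, and d + (d + k - 1) = j + 2. *)
Lemma has_diag_lengthsP j' P : symmetric_partition j' P ->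
  has_diag_lengths P d k <-> j' = j /\ (size P = d \/ size P = d + k - 1).
Proof.
move=> symP; have diag := diag_length_sym symP; split=> [T|[jE sP] i].
  have s0 : 0 < size P.
    by have := diag 0; rewrite T T_seqE; lia.
  have sj : size P <= j'.+1.
    have ls : (size P).-1 < size P by lia.
    by have [v [_ E _]] := dual_part symP ls; move: ls; rewrite (part_gt0 symP); lia.
  have jE : j' = j.
    have := diag j'; have := diag j; rewrite !T !T_seqE /socle_deg; lia.
  split=> //; have := diag d; have := diag d.-1; rewrite !T !T_seqE jE /socle_deg; lia.
move: (diag i); rewrite jE T_seqE /socle_deg; lia.
Qed.

(** The last block of the partition has d + k - 1 - n rows, which completes the composition of n to
    one of d + k - 1; for n = d there are d parts and nothing is added. *)
Definition block_sizes ns : seq nat :=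
  if sumn ns == d then ns else rcons ns (d + k - 1 - sumn ns).

(** Since j + 2 = 2 d + k - 1, the formula for p_i is j + 2 - 2 b - n_i with b the sum of the
    preceding blocks, and the completing block has parts d - n. *)
Lemma hess_partitionE ns : sumn ns <= d ->
  hess_partition d k ns = layered j 0 (block_sizes ns).
Proof.
have H : flatten [seq nseq (nth 0 ns i.-1) (part_size d k ns i) | i <- iota 1 (size ns)]
    = layered j 0 ns.
  elim/last_ind: ns => [//|ns n IH].
  rewrite size_rcons -(addn1 (size ns)) iotaD map_cat flatten_cat layered_rcons /= cats0.
  rewrite add1n nth_rcons ltnn eqxx; congr (_ ++ nseq _ _).
    rewrite -IH; congr flatten; apply/eq_in_map => i; rewrite mem_iota => hi.
    rewrite /part_size /psum !nth_rcons (_ : i.-1 < size ns); last by lia.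
    by rewrite -cats1 takel_cat //; lia.
  rewrite /part_size /psum /= nth_rcons ltnn eqxx -cats1 take_size_cat //.
  by rewrite /socle_deg; lia.
move=> nd; rewrite /hess_partition H /block_sizes; case: eqP => [_|ne].
  by rewrite cats0.
rewrite layered_rcons add0n; congr (_ ++ nseq _ _); rewrite /socle_deg; lia.
Qed.

Lemma sumn_block_sizes ns : sumn ns <= d ->
  sumn (block_sizes ns) = if sumn ns == d then d else d + k - 1.
Proof.
by move=> nd; rewrite /block_sizes; case: eqP => // ne; rewrite sumn_rcons; lia.
Qed.

Lemma nactiveE : nactive d k = if 1 < k then d else d - 1.
Proof. by rewrite /nactive subn1. Qed.

(** A boundary below [size P] and outside the active range would violate [boundary_lt_size]. *)
Lemma boundary_inactive P b : symmetric_partition j P -> has_diag_lengths P d k ->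
  nactive d k < b <= size P -> boundary j P b = (b == size P).
Proof.
move=> symP /(has_diag_lengthsP symP)[_ sP] hb.
apply/idP/eqP => [bb|->]; last exact: boundary_size.
apply/eqP; rewrite eqn_leq; apply/andP; split; first by lia.
rewrite leqNgt; apply/negP => lt; have := boundary_lt_size symP bb lt.
by move: hb; rewrite nactiveE /socle_deg; case: ifP; case: sP => ->; lia.
Qed.

(** For k > 1 the Hessian of index d - 1 separates the two possible numbers of parts: d + (d + k -
    1) exceeds j + 1, so d is no boundary when there are d + k - 1 parts. *)
Lemma boundary_d P : symmetric_partition j P -> has_diag_lengths P d k ->
  1 < k -> boundary j P d = (size P == d).
Proof.
move=> symP /(has_diag_lengthsP symP)[_ sP] k1.
apply/idP/eqP => [bb|E]; last by have := boundary_size symP; rewrite E.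
case: sP => // sP; apply/eqP; rewrite sP; apply: contraT => ne.
have := boundary_lt_size symP bb; rewrite sP /socle_deg; lia.
Qed.

(** Injectivity of the correspondence: the active boundaries determine the number of parts, and with
    it all remaining boundaries. *)
Lemma active_boundaries_eq P Q :
  symmetric_partition j P -> has_diag_lengths P d k ->
  symmetric_partition j Q -> has_diag_lengths Q d k ->
  (forall i, i < nactive d k -> boundary j P i.+1 = boundary j Q i.+1) -> P = Q.
Proof.
move=> symP TP symQ TQ H.
have [_ sP] := (has_diag_lengthsP symP).1 TP.
have [_ sQ] := (has_diag_lengthsP symQ).1 TQ.
have sPQ : size P = size Q.
  have [k1|k1] := ltnP 1 k; last by lia.
  have dd : d.-1 < nactive d k by rewrite nactiveE k1; lia.
  have := H d.-1 dd; rewrite (_ : d.-1.+1 = d) ?boundary_d //; lia.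
apply: (symmetric_partition_eq symP symQ sPQ) => b hb.
have [lt|le] := ltnP (nactive d k) b.
  by rewrite !boundary_inactive // -?sPQ ?lt; lia.
by case: b hb le => // b _; apply: H.
Qed.

Lemma hess_partition_of_boundaries P ns :
  symmetric_partition j P -> has_diag_lengths P d k ->
  all (fun m => 0 < m) ns -> sumn ns <= nactive d k ->
  (forall i, 0 < i <= size ns -> boundary j P (psum ns i)) ->
  (forall t, t < nactive d k ->
     (forall i, 0 < i <= size ns -> t <> psum ns i - 1) -> ~~ boundary j P t.+1) ->
  P = hess_partition d k ns.
Proof.
move=> symP TP pos nle Hbd Hnbd.
have nd : sumn ns <= d by move: nle; rewrite nactiveE; case: ifP; lia.
have [_ sP] := (has_diag_lengthsP symP).1 TP.
have pse i : psum ns i <= sumn ns.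
  by rewrite /psum -{2}(cat_take_drop i ns) sumn_cat leq_addr.
have ps0 i : 0 < i <= size ns -> 0 < psum ns i.
  move=> hi; rewrite /psum; case: ns pos hi {Hbd Hnbd nle nd pse} => [|n ns] /=; first by lia.
  by case: i => //= i /andP[n0 _] _; rewrite addn_gt0 n0.
have active b : 0 < b <= nactive d k -> boundary j P b = (b \in scanl addn 0 ns).
  move=> hb; apply/idP/idP => [bb|/mem_scanl_addn[i hi ->]]; last exact: Hbd.
  apply: contraT => nb; have tb : b.-1 < nactive d k by lia.
  have /negP[] : ~~ boundary j P b.-1.+1; last by rewrite prednK //; lia.
  apply: Hnbd tb _ => i hi E; case/negP: nb; apply/mem_scanl_addn; exists i => //.
  by have := ps0 i hi; rewrite -/(psum ns i); lia.
have inact b : nactive d k < b -> (b \in scanl addn 0 ns) = false.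
  move=> lt; apply/negP => /mem_scanl_addn[i hi E].
  by have := pse i; rewrite /psum; lia.
(* If n = d then k > 1 and d is a boundary, so there are d parts. Otherwise d is not a partial sum
   and there are d + k - 1. *)
have sE : size P = sumn (block_sizes ns).
  rewrite sumn_block_sizes //; case: eqP => [nE|ne].
    have k1 : 1 < k by move: nle; rewrite nactiveE nE; case: ifP; lia.
    apply/eqP; rewrite -(boundary_d symP TP k1) active ?nactiveE ?k1; last by lia.
    apply/mem_scanl_addn; exists (size ns); last by rewrite take_size nE.
    by rewrite leqnn andbT; case: (ns) nE => //=; lia.
  case: sP => // sP; have [k1|k1] := ltnP 1 k; last by lia.
  have := boundary_d symP TP k1; rewrite sP eqxx active ?nactiveE ?k1; last by lia.
  move/mem_scanl_addn => [i hi E]; have := pse i; rewrite /psum; lia.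
rewrite hess_partitionE // -[LHS]drop0; apply: (drop_layered symP) => //.
- rewrite /block_sizes; case: eqP => // ne; rewrite all_rcons pos andbT; lia.
have nact : nactive d k < d + k - 1 by rewrite nactiveE; case: ifP; lia.
move=> b hb; have [lt|le] := ltnP (nactive d k) b.
  rewrite boundary_inactive // ?lt //; last by lia.
  move: hb; rewrite sE /block_sizes; case: eqP => ne hb.
    by move: nle lt hb; rewrite nactiveE; case: ifP; lia.
  by rewrite scanl_addn_rcons mem_rcons inE inact // orbF sumn_rcons.
rewrite active; last by lia.
rewrite /block_sizes; case: eqP => // ne.
rewrite scanl_addn_rcons mem_rcons inE (_ : b == _ = false) //; lia.
Qed.

End SocleDegree.

Import GRing.Theory.
Local Open Scope ring_scope.

(** * Coordinates adapted to a linear form *)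

Lemma poly_sum_le (K : nzRingType) n (q : {poly K}) : (size q <= n)%N ->
  q = \sum_(u < n) q`_u *: 'X^u.
Proof.
move=> sq; rewrite -poly_def; apply/polyP => i; rewrite coef_poly.
by case: ltnP => // ni; rewrite nth_default // (leq_trans sq).
Qed.

Lemma coef_sum_Xn (K : nzRingType) n (c : 'I_n -> K) (u : 'I_n) :
  (\sum_(v < n) c v *: 'X^v : {poly K})`_u = c u.
Proof.
rewrite coef_sum (bigD1 u) //= coefZ coefXn eqxx mulr1 big1 ?addr0 // => v vu.
by rewrite coefZ coefXn eq_sym (_ : (v == u :> nat) = false) ?mulr0 //; apply: negbTE.
Qed.

Lemma size_sum_Xn (K : nzRingType) n (c : 'I_n -> K) :
  (size (\sum_(u < n) c u *: 'X^u : {poly K})%R <= n)%N.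
Proof.
apply: (leq_trans (size_sum _ _ _)); apply/bigmax_leqP => u _.
by apply: (leq_trans (size_scale_leq _ _)); rewrite size_polyXn.
Qed.

Section Coordinates.
Variable K : fieldType.
Local Notation R := {mpoly K[2]}.

Definition dehom (h : 'I_2 -> {poly K}) : R -> {poly K} := mmap (@polyC K) h.

HB.instance Definition _ h := GRing.RMorphism.copy (dehom h) (mmap (@polyC K) h).

Lemma dehomZ h c p : dehom h (c *: p) = c *: dehom h p.
Proof. by rewrite /dehom mmapZ mul_polyC. Qed.

Lemma dehomX h i : dehom h 'X_i = h i.
Proof. by rewrite /dehom mmapX mmap1U. Qed.

(* In the basis (l, m) of the linear forms, dehom h sets l = 1 and m = 'X. *)
Definition coordinates (l m : R) (h : 'I_2 -> {poly K}) : Prop :=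
  [/\ l \is 1.-homog, m \is 1.-homog, dehom h l = 1, dehom h m = 'X
    & forall i, exists a b, 'X_i = a *: l + b *: m].

(** The homogenization l^e q(m / l); coefficients of q above degree e are dropped. The lock prevents
    unwanted unfolding of the sum. *)
Definition hform (l m : R) (e : nat) (q : {poly K}) : R :=
  locked (\sum_(u < e.+1) q`_u *: (l ^+ (e - u) * m ^+ u)).

Lemma hformE l m e q :
  hform l m e q = \sum_(u < e.+1) q`_u *: (l ^+ (e - u) * m ^+ u).
Proof. by rewrite /hform -lock. Qed.

Lemma linear_formE (l : R) : l \is 1.-homog ->
  l = l@_U_(ord0) *: 'X_ord0 + l@_U_(ord_max) *: 'X_ord_max.
Proof.
move=> hl; apply/mpolyP => m; rewrite mcoeffD !mcoeffZ !mcoeffX.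
have ne : (U_(ord0) == U_(ord_max) :> 'X_{1..2})%MM = false.
  by apply/eqP => /mnmP/(_ ord0); rewrite !mnm1E.
have [/eqP/mdeg1P[i /eqP ->]|nm] := altP (mdeg m =P 1%N).
  have [->|->] : i = ord0 \/ i = ord_max.
    by case: i => [[|[|?]]] //= ?; [left|right]; apply: val_inj.
  - by rewrite eqxx eq_sym ne mulr1 mulr0 addr0.
  - by rewrite eqxx ne mulr1 mulr0 add0r.
rewrite (dhomog_nemf_coeff hl nm).
have U (i : 'I_2) : (U_(i) == m)%MM = false.
  by apply: negbTE; apply: contraNneq nm => <-; rewrite mdeg1.
by rewrite !U !mulr0 addr0.
Qed.

Lemma linear_formX : linear_form ('X_ord0 : R).
Proof. by split; rewrite ?dhomogX /= ?mdeg1 // -msupp_eq0 msuppX. Qed.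

(** Take for m a variable independent of l = a x + b y, that is y if a is nonzero and x otherwise,
    and solve a h_0 + b h_1 = 1 for the remaining value of h. *)
Lemma coordinates_exist (l : R) : linear_form l ->
  exists m h, coordinates l m h.
Proof.
case=> hl l0; have lE := linear_formE hl.
set a := l@_U_(ord0) in lE; set b := l@_U_(ord_max) in lE.
have ordE (P : 'I_2 -> Prop) : P ord0 -> P ord_max -> forall i, P i.
  by move=> P0 P1 [[|[|?]]] //= ?; [move: P0 | move: P1]; congr P; apply: val_inj.
have [a0|a0] := eqVneq a 0.
  have b0 : b != 0.
    by apply: contra_neq l0 => b0; rewrite lE a0 b0 !scale0r addr0.
  exists 'X_ord0, (fun i => if i == ord0 then 'X else b^-1%:P); split=> //.
  - by rewrite dhomogX /= mdeg1.
  - rewrite lE a0 scale0r add0r dehomZ dehomX /= -mul_polyC -polyCM mulfV //.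
  - by rewrite dehomX eqxx.
  - apply: ordE; first by exists 0, 1; rewrite scale0r scale1r add0r.
    by exists b^-1, 0; rewrite scale0r addr0 lE a0 scale0r add0r scalerA mulVf // scale1r.
exists 'X_ord_max, (fun i => if i == ord0 then a^-1 *: (1 - b *: 'X) else 'X).
split=> //.
- by rewrite dhomogX /= mdeg1.
- by rewrite lE rmorphD /= !dehomZ !dehomX /= scalerA mulfV // scale1r subrK.
- by rewrite dehomX.
- apply: ordE; last by exists 0, 1; rewrite scale0r scale1r add0r.
  exists a^-1, (- (a^-1 * b)); rewrite {1}lE scalerDr !scalerA mulVf // scale1r.
  by rewrite scaleNr addrK.
Qed.

Section Fixed.
Variables (l m : R) (h : 'I_2 -> {poly K}).
Hypothesis lmh : coordinates l m h.

Lemma hform_is_linear e : linear (hform l m e).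
Proof.
move=> c p q; rewrite !hformE scaler_sumr -big_split /=; apply: eq_bigr => u _.
by rewrite coefD coefZ scalerDl scalerA.
Qed.

HB.instance Definition _ e := GRing.isLinear.Build K {poly K} R _ (hform l m e)
  (hform_is_linear e).

Lemma hform_homog e q : hform l m e q \is e.-homog.
Proof.
case: lmh => hl hm _ _ _.
rewrite hformE; apply/rpred_sum => u _; apply/rpredZ.
have := dhomogM (dhomogMn (e - u) hl) (dhomogMn u hm).
by rewrite !mul1n subnK // -ltnS.
Qed.

Lemma dehom_hform e (q : {poly K}) : (size q <= e.+1)%N ->
  dehom h (hform l m e q) = q.
Proof.
case: lmh => _ _ hl hm _ sq; rewrite hformE rmorph_sum [RHS](poly_sum_le sq) /=.
apply: eq_bigr => u _.
by rewrite dehomZ rmorphM !rmorphXn /= hl hm expr1n mul1r.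
Qed.

Lemma hformSl e (q : {poly K}) : (size q <= e.+1)%N ->
  hform l m e.+1 q = l * hform l m e q.
Proof.
move=> sq; rewrite !hformE big_ord_recr /= nth_default // scale0r addr0 mulr_sumr.
by apply: eq_bigr => u _; rewrite -scalerAr mulrA -exprS -subSn // -ltnS.
Qed.

Lemma hformSr e q : hform l m e.+1 (q * 'X) = m * hform l m e q.
Proof.
rewrite !hformE big_ord_recl /= coefMX /= scale0r add0r mulr_sumr.
apply: eq_bigr => u _; rewrite coefMX /= -scalerAr subSS mulrCA.
by rewrite /bump /= add1n -exprS.
Qed.

(** Monomials are built one variable at a time; each variable is a combination of l and m, and
    multiplication by these is [hformSl] and [hformSr]. *)
Lemma homog_hform e p : p \is e.-homog ->
  exists2 q : {poly K}, (size q <= e.+1)%N & p = hform l m e q.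
Proof.
case: lmh => hl hm evl evm span.
pose S e p := exists2 q : {poly K}, (size q <= e.+1)%N & p = hform l m e q.
have mono : forall e (mu : 'X_{1..2}), mdeg mu = e -> S e 'X_[mu].
  elim=> [|{}e IH] mu degmu.
    exists 1; first by rewrite size_poly1.
    rewrite hformE big_ord1 subn0 !expr0 mulr1 coef1 scale1r.
    by move/eqP: degmu; rewrite mdeg_eq0 => /eqP ->; rewrite mpolyX0.
  have [i mui] : exists i, mu i != 0%N.
    apply/existsP; apply: contraT => /existsPn H.
    suff mu0 : mu = 0%MM by rewrite mu0 mdeg0 in degmu.
    by apply/mnmP => i; rewrite mnm0E; apply/eqP; move: (H i); rewrite negbK.
  have muE : (mu - U_(i) + U_(i))%MM = mu.
    apply: submK; apply/mnm_lepP => t; rewrite mnm1E.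
    by case: eqP => // <-; rewrite lt0n.
  have [|q sq qE] := IH (mu - U_(i))%MM.
    by apply/eqP; rewrite -eqSS -degmu -{2}muE mdegD mdeg1 addn1.
  have [a [b Xi]] := span i.
  exists (a *: q + b *: (q * 'X)).
    apply: (leq_trans (size_polyD _ _)); rewrite geq_max.
    apply/andP; split; apply: (leq_trans (size_scale_leq _ _)).
      exact: leq_trans sq _.
    have [->|q0] := eqVneq q 0; first by rewrite mul0r size_poly0.
    by rewrite size_mulX.
  rewrite linearD !linearZ /= hformSl // hformSr -muE mpolyXD Xi qE.
  by rewrite mulrDr -!scalerAr ![_ * hform _ _ _ _]mulrC.
move=> hp; rewrite [p]mpolyE big_seq.
apply: (big_ind (S e)).
- by exists 0; rewrite ?size_poly0 // linear0.
- move=> _ _ [q sq ->] [q' sq' ->]; exists (q + q'); last by rewrite linearD.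
  by apply: (leq_trans (size_polyD _ _)); rewrite geq_max sq.
- move=> mu mup; have [q sq ->] := mono e mu (dhomog_mf hp mup).
  exists (p@_mu *: q); last by rewrite linearZ.
  exact: leq_trans (size_scale_leq _ _) sq.
Qed.

Lemma hform_dehom e p : p \is e.-homog -> hform l m e (dehom h p) = p.
Proof. by case/homog_hform => q sq ->; rewrite dehom_hform. Qed.

Lemma size_dehom e p : p \is e.-homog -> (size (dehom h p) <= e.+1)%N.
Proof. by case/homog_hform => q sq ->; rewrite dehom_hform. Qed.

Lemma dehom_inj e p q : p \is e.-homog -> q \is e.-homog ->
  dehom h p = dehom h q -> p = q.
Proof. by move=> /hform_dehom {2}<- /hform_dehom {2}<- ->. Qed.

Lemma hformM e e' (q q' : {poly K}) : (size q <= e.+1)%N -> (size q' <= e'.+1)%N ->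
  hform l m e q * hform l m e' q' = hform l m (e + e') (q * q').
Proof.
move=> sq sq'; apply: (@dehom_inj (e + e')).
- exact: dhomogM (hform_homog _ _) (hform_homog _ _).
- exact: hform_homog.
- rewrite rmorphM /= !dehom_hform //.
  have [->|q0] := eqVneq q 0; first by rewrite mul0r size_poly0.
  have [->|q'0] := eqVneq q' 0; first by rewrite mulr0 size_poly0.
  apply: (leq_trans (size_polyMleq _ _)); move: sq sq'.
  by rewrite -size_poly_gt0 in q0; lia.
Qed.

Lemma hform_lpow c e (q : {poly K}) : (size q <= e.+1)%N ->
  l ^+ c * hform l m e q = hform l m (c + e) q.
Proof.
move=> sq; elim: c => [|c IH]; first by rewrite mul1r.
by rewrite exprS -mulrA IH addSn hformSl // (leq_trans sq) // ltnS leq_addl.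
Qed.

End Fixed.
End Coordinates.

(** * Jordan types modulo an ideal *)

Section Modulo.
Variable K : fieldType.
Local Notation R := {mpoly K[2]}.
Variable I : R -> Prop.

Definition subspace : Prop :=
  [/\ I 0, forall p q, I p -> I q -> I (p + q) & forall c p, I p -> I (c *: p)].

Hypothesis subI : subspace.

Definition spanned (J : finType) (e : J -> R) (p : R) : Prop :=
  exists c : J -> K, I (p - \sum_t c t *: e t).

Lemma subspace_sum (T : Type) (s : seq T) (P : pred T) (F : T -> R) :
  (forall t, P t -> I (F t)) -> I (\sum_(t <- s | P t) F t).
Proof. by case: subI => I0 ID _ H; apply: (big_ind I). Qed.

Section Spanned.
Variables (J : finType) (e : J -> R).

Lemma spannedD p q : spanned e p -> spanned e q -> spanned e (p + q).
Proof.
case: subI => _ ID _ [c hc] [c' hc']; exists (fun t => c t + c' t).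
rewrite (eq_bigr (fun t => c t *: e t + c' t *: e t)); last first.
  by move=> t _; rewrite scalerDl.
by rewrite big_split /= opprD addrACA; apply: ID.
Qed.

Lemma spannedZ a p : spanned e p -> spanned e (a *: p).
Proof.
case: subI => _ _ IZ [c hc]; exists (fun t => a * c t).
rewrite (eq_bigr (fun t => a *: (c t *: e t))); last first.
  by move=> t _; rewrite scalerA.
by rewrite -scaler_sumr -scalerBr; apply: IZ.
Qed.

Lemma spanned_mod p : I p -> spanned e p.
Proof.
move=> Ip; exists (fun=> 0); rewrite big1 ?subr0 // => t _; exact: scale0r.
Qed.

Lemma spanned0 : spanned e 0.
Proof. by apply: spanned_mod; case: subI. Qed.

Lemma spanned_sum (T : Type) (s : seq T) (P : pred T) (F : T -> R) :
  (forall t, P t -> spanned e (F t)) -> spanned e (\sum_(t <- s | P t) F t).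
Proof. by move=> H; apply: (big_ind (spanned e)) => //; [exact: spanned0 | exact: spannedD]. Qed.

Lemma spanned_basis t : spanned e (e t).
Proof.
exists (fun t' => (t' == t)%:R); rewrite (bigD1 t) //= eqxx scale1r big1.
  by rewrite addr0 subrr; case: subI.
by move=> t' /negbTE ->; rewrite scale0r.
Qed.

End Spanned.

(** No quotient space is formed. The matrix expressing [e] through [e'] modulo I is row free,
    because a relation between its rows is a relation between the [e t] modulo I. *)
Lemma basis_mod_card_le (V : R -> Prop) (J J' : finType) (e : J -> R) (e' : J' -> R) :
  basis_mod I V e -> basis_mod I V e' -> (#|J| <= #|J'|)%N.
Proof.
case: subI => I0 ID IZ [Ve free _] [_ _ span].
have /fin_all_exists[M MP] : forall t, exists c : {ffun J' -> K},
    I (e t - \sum_s c s *: e' s).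
  move=> t; have [c hc] := span _ (Ve t); exists (finfun c).
  by under eq_bigr do rewrite ffunE.
pose A : 'M[K]_(#|J|, #|J'|) := \matrix_(u, v) M (enum_val u) (enum_val v).
suff /eqP <- : row_free A by apply: rank_leq_col.
apply: inj_row_free => w wA.
pose c t := w ord0 (enum_rank t).
have ME s : \sum_t c t * M t s = 0.
  move/rowP/(_ (enum_rank s)): wA; rewrite !mxE => E; rewrite -[RHS]E.
  rewrite (reindex _ (onW_bij _ (enum_rank_bij J))) /=; apply: eq_bigr => t _.
  by rewrite mxE !enum_rankK.
have c0 : forall t, c t = 0.
  apply: free.
  have -> : \sum_t c t *: e t = \sum_t c t *: (e t - \sum_s M t s *: e' s).
    under [RHS]eq_bigr do rewrite scalerBr.
    rewrite sumrB [X in _ - X](_ : _ = 0) ?subr0 //.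
    under eq_bigr do rewrite scaler_sumr.
    rewrite exchange_big big1 //= => s _.
    under eq_bigr do rewrite scalerA.
    by rewrite -scaler_suml ME scale0r.
  by apply: subspace_sum => t _; apply: IZ.
by apply/rowP => u; rewrite mxE -[u]enum_valK; apply: c0.
Qed.

Lemma basis_mod_card (V : R -> Prop) (J J' : finType) (e : J -> R) (e' : J' -> R) :
  basis_mod I V e -> basis_mod I V e' -> #|J| = #|J'|.
Proof.
move=> be be'; apply/eqP; rewrite eqn_leq.
by rewrite (basis_mod_card_le be be') (basis_mod_card_le be' be).
Qed.

Lemma basis_mod_artinian (J : finType) (e : J -> R) :
  basis_mod I (@whole K) e -> artinian I.
Proof.
case=> _ free span; exists #|J|, (fun u => e (enum_val u)); split=> //.
  move=> c Ic u; rewrite -[u]enum_valK; apply: (free (fun t => c (enum_rank t))).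
  rewrite (reindex _ (onW_bij _ (enum_val_bij J))) /=.
  by under eq_bigr do rewrite enum_valK.
move=> f Vf; have [c hc] := span f Vf; exists (fun u => c (enum_val u)).
by move: hc; rewrite (reindex _ (onW_bij _ (enum_val_bij J))).
Qed.

End Modulo.

(** * Uniqueness of the Jordan type *)

Lemma sumn_subS P n :
  sumn [seq (p - n)%N | p <- P] = (sumn [seq (p - n.+1)%N | p <- P] + count (ltn n) P)%N.
Proof. by elim: P => //= p P ->; lia. Qed.

(** Successive differences of these sums count the parts larger than n, and differences of those
    counts are the multiplicities. *)
Lemma partition_eq P Q : is_partition P -> is_partition Q ->
  (forall n, sumn [seq (p - n)%N | p <- P] = sumn [seq (p - n)%N | p <- Q]) -> P = Q.
Proof.
move=> /andP[sP pP] /andP[sQ pQ] E.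
have cnt n : count (ltn n) P = count (ltn n) Q.
  by apply/eqP; move: (sumn_subS P n); rewrite E sumn_subS E => /addnI ->.
have cntS n (s : seq nat) : count (ltn n) s = (count_mem n.+1 s + count (ltn n.+1) s)%N.
  by elim: s => //= p s ->; case: (ltngtP n p); case: (ltngtP n.+1 p); lia.
have c0 (s : seq nat) : all (fun p => 0 < p)%N s -> count_mem 0%N s = 0%N.
  by move=> /allP s0; apply/count_memPn/negP => /s0.
apply: (sorted_eq (leT := geq)) => //.
- by move=> a b c ba ac; apply: leq_trans ac ba.
- by move=> a b ab; apply/eqP; rewrite eqn_leq andbC.
apply/allP => -[|n] _ /=; first by rewrite !c0.
by move: (cnt n); rewrite (cntS n P) (cntS n Q) cnt => /addIn ->.
Qed.

Section JordanUnique.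
Variable K : fieldType.
Local Notation R := {mpoly K[2]}.
Variables (I : R -> Prop) (l : R).
Hypothesis subI : subspace I.
Hypothesis IM : forall g p, I p -> I (g * p).

Definition power_image n : R -> Prop := fun p => exists g, I (p - l ^+ n * g).

(** The elements l^c z_r with c >= n form a basis of the image of l^n; row r contributes p_r - n of
    them. So P is determined by the ranks of the powers of l. *)
Lemma jordan_type_image_basis P n : jordan_type I l P ->
  exists (J : finType) (e : J -> R), basis_mod I (power_image n) e /\
    #|J| = sumn [seq (p - n)%N | p <- P].
Proof.
case=> _ [z [[_ free span] zP]].
pose J := {r : 'I_(size P) & 'I_(nth 0%N P r)}.
pose e (t : J) := l ^+ tagged t * z (tag t).
pose A := [pred t : J | (n <= tagged t)%N].
pose Jn := {t : J | t \in A}.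
exists Jn, (fun t => e (val t)); split; last first.
  rewrite card_sig -sum1_card big_mkcond /=.
  transitivity (\sum_(r < size P) \sum_(c < nth 0%N P r) (if (n <= c)%N then 1%N else 0%N))%N.
    rewrite (sig_big_dep (fun _ => true) (fun _ _ => true)
      (fun (r : 'I_(size P)) (c : 'I_(nth 0%N P r)) => if (n <= c)%N then 1%N else 0%N)) /=.
    by apply: eq_bigr => -[].
  rewrite sumnE big_map (big_nth 0%N) big_mkord; apply: eq_bigr => r _.
  elim: (nth 0%N P r) => [|p IH]; first by rewrite big_ord0.
  by rewrite big_ord_recr /= IH; case: (leqP n p); lia.
split.
- move=> [t nt]; exists (l ^+ (tagged t - n) * z (tag t)).
  by rewrite mulrA -exprD subnKC // subrr; case: subI.
(* The coefficients are extended by zero to all cells, where freeness is known. *)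
- move=> c Ic t; pose c' t' := odflt 0 (omap c (insub t' : option Jn)).
  rewrite -[c t]/(odflt 0 (omap c (Some t))) -(valK t) -/(c' (val t)).
  apply: free; rewrite (bigID (fun t' : J => t' \in A)) /=.
  rewrite [X in _ + X]big1 ?addr0; last first.
    by move=> t' nt'; rewrite /c' insubN // scale0r.
  rewrite big_sub (eq_bigr (fun t' => c t' *: e (val t'))) // => t' _.
  by rewrite /c' valK.
- move=> f [g hg].
  have [b hb] := span g Logic.I.
  rewrite -(subrK (l ^+ n * g) f); apply: (spannedD subI); first exact: spanned_mod.
  rewrite -(subrK (\sum_t b t *: e t) g) mulrDr; apply: (spannedD subI).
    by apply: spanned_mod; apply: IM.
  rewrite mulr_sumr; apply: (spanned_sum subI) => t _; rewrite -scalerAr.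
  apply: (spannedZ subI); rewrite /e mulrA -exprD.
  (* Multiplication by l^n moves an element along its string, or past the end into I. *)
  have [lt|ge] := ltnP (n + tagged t) (nth 0%N P (tag t)).
    have nt : (existT _ (tag t) (Ordinal lt) : J) \in A by rewrite inE leq_addr.
    exact: (spanned_basis subI (fun t : Jn => e (val t)) (exist (fun t0 => t0 \in A) _ nt : Jn)).
  apply: spanned_mod; rewrite -(subnK ge) exprD -mulrA; apply: IM; exact: zP.
Qed.

Lemma jordan_type_unique P Q : jordan_type I l P -> jordan_type I l Q -> P = Q.
Proof.
move=> jP jQ; apply: partition_eq; first by case: jP.
  by case: jQ.
move=> n; have [J [e [be <-]]] := jordan_type_image_basis n jP.
have [J' [e' [be' <-]]] := jordan_type_image_basis n jQ.
exact: (basis_mod_card subI be be').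
Qed.

End JordanUnique.

(** * Dual functionals and Hankel matrices *)

Section Duality.
Variable K : fieldType.
Local Notation R := {mpoly K[2]}.

(** Macaulay duality: phi lives in degree j, and I is the largest ideal inside its kernel. This form
    covers both annihilators of forms and ideals generated by two forms. *)
Definition dual_functional (I : R -> Prop) (j : nat) (phi : {scalar R}) : Prop :=
  (forall e p, p \is e.-homog -> e != j -> phi p = 0) /\
  (forall p, I p <-> forall g, phi (g * p) = 0).

Lemma homog_sumE (p : R) : p = \sum_(e < msize p) pihomog mdeg e p.
Proof. exact: pihomog_partitionE. Qed.

Section Ideal.
Variables (I : R -> Prop) (j : nat) (phi : {scalar R}).
Hypothesis Iphi : dual_functional I j phi.

Lemma dual_ideal0 : I 0.
Proof. by case: Iphi => _ ->; move=> g; rewrite mulr0 linear0. Qed.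

Lemma dual_idealD p q : I p -> I q -> I (p + q).
Proof.
case: Iphi => _ IP /IP hp /IP hq; apply/IP => g.
by rewrite mulrDr linearD /= hp hq addr0.
Qed.

Lemma dual_idealM g p : I p -> I (g * p).
Proof. by case: Iphi => _ IP /IP hp; apply/IP => g'; rewrite mulrA. Qed.

Lemma dual_idealZ c p : I p -> I (c *: p).
Proof. by rewrite -mul_mpolyC; apply: dual_idealM. Qed.

Lemma dual_subspace : subspace I.
Proof.
by split; [exact: dual_ideal0 | exact: dual_idealD | exact: dual_idealZ].
Qed.

(** Against the degree e component of p only the component of g of degree j - e counts, and there p
    and its component have the same value under phi. *)
Lemma dual_ideal_pihomog p e : I p -> I (pihomog mdeg e p).
Proof.
case: Iphi => deg IP /IP hp; apply/IP => g.
rewrite [g in LHS]homog_sumE mulr_suml linear_sum /= big1 // => d _.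
set gd := pihomog mdeg d g.
have gd_hom : gd \is d.-homog by apply: pihomogP.
have [de|de] := eqVneq (d + e)%N j; last first.
  by apply: deg de; apply: dhomogM => //; apply: pihomogP.
transitivity (phi (gd * p)); last exact: hp.
rewrite [in RHS](homog_sumE p) [in RHS]mulr_sumr [in RHS]linear_sum /=.
have [e_lt|e_ge] := ltnP e (msize p).
  rewrite (bigD1 (Ordinal e_lt)) //= [X in _ + X]big1 ?addr0 // => e' ne.
  apply: (deg (d + e')%N); first by apply: dhomogM => //; apply: pihomogP.
  rewrite -de eqn_add2l; apply: contraNN ne => /eqP ee'.
  by apply/eqP/val_inj.
have -> : pihomog mdeg e p = 0.
  rewrite pihomogE big_seq_cond big1 // => mu /andP[mup /eqP mue].
  by have := msize_mdeg_lt mup; rewrite mue ltnNge e_ge.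
rewrite mulr0 linear0 big1 // => e' _.
apply: (deg (d + e')%N); first by apply: dhomogM => //; apply: pihomogP.
by rewrite -de eqn_add2l neq_ltn (leq_trans (ltn_ord e') e_ge).
Qed.

Section Fixed.
Variables (l m : R) (h : 'I_2 -> {poly K}).
Hypothesis lmh : coordinates l m h.

Local Notation L q := (phi (hform l m j q)).

(** Only multipliers of degree j - e matter. For e > j the size bound leaves only q' = 0, and every
    form of degree e lies in I. *)
Lemma dual_hform e (q : {poly K}) : (size q <= e.+1)%N ->
  I (hform l m e q) <->
  forall q' : {poly K}, (size q' + e <= j.+1)%N -> L (q * q') = 0.
Proof.
move=> sq; case: Iphi => deg IP; rewrite IP; split=> [H q' sq'|H g].
  have [ej|je] := leqP e j.
    rewrite mulrC -(subnK ej) -(hformM lmh) ?H // -subSn //.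
    by rewrite -(leq_add2r e) subnK // leqW.
  have -> : q' = 0.
    apply/eqP; rewrite -size_poly_leq0 -(leq_add2r e) add0n.
    exact: leq_trans sq' je.
  by rewrite mulr0 !linear0.
rewrite [g]homog_sumE mulr_suml linear_sum /= big1 // => d _.
have gd_hom : pihomog mdeg d g \is d.-homog by apply: pihomogP.
have [de|de] := eqVneq (d + e)%N j; last first.
  by apply: deg de; apply: dhomogM => //; apply: (hform_homog lmh).
rewrite -(hform_dehom lmh gd_hom) (hformM lmh) ?(size_dehom lmh gd_hom) //.
rewrite de mulrC; apply: H; rewrite -de -addSn leq_add2r.
exact: (size_dehom lmh gd_hom).
Qed.

Lemma functional_coef_sum (q : {poly K}) (w : {poly K}) n : (size q <= n)%N ->
  L (w * q) = \sum_(v < n) q`_v * L (w * 'X^v).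
Proof.
move=> sq; rewrite {1}(poly_sum_le sq) mulr_sumr !linear_sum /=.
by apply: eq_bigr => v _; rewrite -scalerAr !linearZ.
Qed.

Definition hankel r n : 'M[K]_(r, n) := \matrix_(u, v) L 'X^(u + v).
Definition hankel_row r n : 'rV[K]_n := \row_v L 'X^(r + v).

(* Some monic polynomial of degree r is orthogonal to all polynomials of
   degree < n. *)
Definition orth r n : bool := (hankel_row r n <= hankel r n)%MS.

(** If [orth r n] holds, [pinvmx] writes the row of index r through the earlier rows. The polynomial
    is monic of degree r in any case. *)
Definition orthopoly r n : {poly K} :=
  'X^r - \sum_(u < r) (hankel_row r n *m pinvmx (hankel r n)) ord0 u *: 'X^u.

Lemma size_orthopoly r n : size (orthopoly r n) = r.+1.
Proof.
by rewrite /orthopoly size_polyDl size_polyXn // size_polyN ltnS size_sum_Xn.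
Qed.

Lemma monic_orthopoly r n : orthopoly r n \is monic.
Proof.
rewrite monicE /orthopoly lead_coefDl ?lead_coefXn //.
by rewrite size_polyN size_polyXn ltnS size_sum_Xn.
Qed.

Lemma orthopolyP r n (q : {poly K}) : orth r n -> (size q <= n)%N ->
  L (orthopoly r n * q) = 0.
Proof.
move=> /mulmxKpV hE sq; rewrite (functional_coef_sum _ sq) big1 // => v _.
rewrite mulrBl !linearB /= -exprD mulr_suml !linear_sum /=.
apply/eqP; rewrite mulf_eq0 subr_eq0; apply/orP; right; apply/eqP.
move/rowP/(_ v): hE; rewrite [in RHS]mxE => <-; rewrite mxE.
by apply: eq_bigr => u _; rewrite [hankel _ _ u v]mxE -scalerAl !linearZ -exprD.
Qed.

Lemma orth_intro r n (Y : {poly K}) : Y \is monic -> size Y = r.+1 ->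
  (forall q : {poly K}, (size q <= n)%N -> L (Y * q) = 0) -> orth r n.
Proof.
move=> Ymon Ysize H; apply/submxP; exists (\row_u (- Y`_u)).
apply/rowP => v; rewrite !mxE.
have := H 'X^v; rewrite size_polyXn => /(_ (ltn_ord v)).
rewrite mulrC (functional_coef_sum _ (_ : (size Y <= r.+1)%N)) ?Ysize //.
rewrite big_ord_recr /= (_ : Y`_r = 1); last first.
  by move: Ymon; rewrite monicE /lead_coef Ysize => /eqP.
rewrite mul1r addrC -exprD addnC => /eqP; rewrite addr_eq0 => /eqP ->.
rewrite -sumrN; apply: eq_bigr => u _.
by rewrite !mxE mulNr -exprD addnC.
Qed.

Lemma orth_of_size r n (q : {poly K}) : size q = r.+1 ->
  (forall v, (v < n)%N -> L (q * 'X^v) = 0) -> orth r n.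
Proof.
move=> sq H; have q0 : lead_coef q != 0.
  by rewrite lead_coef_eq0 -size_poly_eq0 sq.
apply: (@orth_intro _ _ ((lead_coef q)^-1 *: q)).
- by rewrite monicE lead_coefZ mulVf.
- by rewrite size_scale ?invr_eq0.
move=> q' sq'; rewrite -scalerAl !linearZ /= (functional_coef_sum _ sq').
by rewrite big1 ?mulr0 // => v _; rewrite H ?mulr0.
Qed.

Lemma orthW r n n' : (n' <= n)%N -> orth r n -> orth r n'.
Proof.
move=> nn' H; apply: (orth_intro (monic_orthopoly r n) (size_orthopoly r n)).
by move=> q sq; apply: orthopolyP => //; apply: leq_trans nn'.
Qed.

(** Multiply the orthogonal polynomial by X: this costs one degree on the other side. *)
Lemma orthS r n : orth r n -> orth r.+1 n.-1.
Proof.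
case: n => [|n] H.
  by apply: (@orth_intro _ _ 'X^(r.+1)); rewrite ?monicXn ?size_polyXn // => q;
    rewrite size_poly_leq0 => /eqP ->; rewrite mulr0 !linear0.
have Y0 : orthopoly r n.+1 != 0 by rewrite -size_poly_eq0 size_orthopoly.
apply: (@orth_intro _ _ (orthopoly r n.+1 * 'X)).
- by rewrite monicMr ?monic_orthopoly ?monicX.
- by rewrite size_mulX // size_orthopoly.
move=> q sq; rewrite -mulrA; apply: orthopolyP => //.
have [->|q0] := eqVneq q 0; first by rewrite mulr0 size_poly0.
by rewrite mulrC size_mulX.
Qed.

Lemma orth_r0 r : orth r 0.
Proof. by rewrite /orth (thinmx0 (hankel_row r 0)) sub0mx. Qed.

(* A vector outside the row space is detected by a column killing the rows. *)
Lemma not_orth_dual r n : ~~ orth r n ->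
  exists W : {poly K}, [/\ (size W <= n)%N,
    forall q : {poly K}, (size q <= r)%N -> L (W * q) = 0 & L (W * 'X^r) != 0].
Proof.
rewrite /orth submxE => /eqP/rowP/eqfunP /existsP[/= w].
rewrite [X in _ != X]mxE => hw.
pose C := cokermx (hankel r n).
exists (\sum_(v < n) C v w *: 'X^v); split.
- exact: size_sum_Xn.
- move=> q sq; rewrite mulrC mulr_sumr !linear_sum /=.
  have /matrixP H := mulmx_coker (hankel r n).
  rewrite (eq_bigr (fun v => \sum_(u < r) q`_u * (hankel r n u v * C v w))).
    rewrite exchange_big big1 //= => u _.
    by have := H u w; rewrite -mulr_sumr !mxE => ->; rewrite mulr0.
  move=> v _; rewrite -scalerAr !linearZ /= [q * _]mulrC (functional_coef_sum _ sq).
  rewrite mulr_sumr; apply: eq_bigr => u _.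
  by rewrite mulrCA; congr (_ * _); rewrite mulrC [hankel _ _ _ _]mxE -exprD addnC.
- rewrite mulr_suml !linear_sum /=; move: hw; rewrite mxE.
  congr (_ != _); apply: eq_bigr => v _.
  by rewrite -scalerAl !linearZ /= mulrC [hankel_row _ _ _ _]mxE -exprD addnC.
Qed.

(** Otherwise some W of degree less than r is orthogonal to all degrees below n but not to X^n.
    Subtracting a multiple of W from the orthogonal polynomial makes it orthogonal to X^n as well,
    against the maximality of n. *)
Lemma orth_sym r n : orth r n -> ~~ orth r n.+1 -> orth n r.
Proof.
move=> rn rn'; apply: contraT => /not_orth_dual[W [sW W0 Wn]].
case/negP: rn'; pose Y := orthopoly r n.
pose c := L (Y * 'X^n) / L (W * 'X^n).
have sYW : (size (c *: W) < size Y)%N.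
  by rewrite size_orthopoly ltnS (leq_trans (size_scale_leq _ _)).
apply: (@orth_intro _ _ (Y - c *: W)).
- by rewrite monicE lead_coefDl ?size_polyN // -monicE monic_orthopoly.
- by rewrite size_polyDl ?size_polyN // size_orthopoly.
move=> q sq; rewrite (functional_coef_sum _ sq) big1 // => v _.
rewrite mulrBl -scalerAl !linearB !linearZ /=.
have [vn|vn] := ltnP v n.
  by rewrite orthopolyP ?W0 ?size_polyXn ?mulr0 ?subr0 ?mulr0.
have -> : v = n :> nat by apply/eqP; rewrite eqn_leq vn -ltnS ltn_ord.
by rewrite divfK // subrr mulr0.
Qed.

(** A monic Z of degree n with L(Y Z) = 0 together with the polynomials of degree less than n spans
    degree at most n, so Y would be orthogonal to X^n too. With [orth_sym] this says s(s(r)) = r. *)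
Lemma orth_sym_max r n : orth r n -> ~~ orth r n.+1 -> ~~ orth n r.+1.
Proof.
move=> rn; apply: contraNN => nr; pose Y := orthopoly r n.
have [Z [sZ Zmon YZ]] : exists Z : {poly K},
    [/\ size Z = n.+1, Z \is monic & L (Y * Z) = 0].
  exists (orthopoly n r.+1); rewrite size_orthopoly monic_orthopoly.
  by split=> //; rewrite mulrC orthopolyP // size_orthopoly.
apply: (orth_intro (monic_orthopoly r n) (size_orthopoly r n)) => q sq.
pose c := q`_n.
have -> : q = c *: Z + (q - c *: Z) by rewrite addrC subrK.
have cYZ : L (Y * (c *: Z)) = 0 by rewrite -scalerAr !linearZ /= YZ mulr0.
rewrite mulrDr (linearD (hform l m j)) (linearD phi) /= cYZ add0r.
apply: orthopolyP => //; apply/leq_sizeP => i; rewrite leq_eqVlt => /orP[/eqP<-|ni].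
  rewrite coefB coefZ.
  move: Zmon; rewrite monicE /lead_coef sZ => /eqP ->.
  by rewrite mulr1 subrr.
by rewrite coefB coefZ !nth_default ?sZ ?mulr0 ?subrr // (leq_trans sq).
Qed.

Lemma orth_row_length_ex r : exists p, orth r (j.+1 - r - p).
Proof. by exists (j.+1 - r)%N; rewrite subnn orth_r0. Qed.

(* The least p such that l^p Y is in I for some Y = m^r + ... of degree r. *)
Definition row_length r := ex_minn (orth_row_length_ex r).

Lemma orth_row_length r : orth r (j.+1 - r - row_length r).
Proof. by rewrite /row_length; case: ex_minnP. Qed.

Lemma row_length_min r p : orth r (j.+1 - r - p) -> (row_length r <= p)%N.
Proof. by rewrite /row_length; case: ex_minnP => q _; apply. Qed.

Lemma row_length_hform e r (q : {poly K}) : size q = r.+1 -> (r <= e)%N ->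
  I (hform l m e q) -> (row_length r <= e - r)%N.
Proof.
move=> sq re; rewrite dual_hform ?sq // => H.
apply/row_length_min/(orth_of_size sq) => v hv.
by apply: H; rewrite size_polyXn; lia.
Qed.

Lemma row_length_le r : (row_length r <= j.+1 - r)%N.
Proof. by apply: row_length_min; rewrite subnn orth_r0. Qed.

Lemma row_lengthS r : (row_length r.+1 <= row_length r)%N.
Proof.
apply: row_length_min.
suff -> : (j.+1 - r.+1 - row_length r = (j.+1 - r - row_length r).-1)%N.
  exact/orthS/orth_row_length.
by rewrite subnS -!subn1 subnAC.
Qed.

Lemma row_length_mono r r' : (r <= r')%N -> (row_length r' <= row_length r)%N.
Proof.
elim: r' => [|r' IH]; first by rewrite leqn0 => /eqP ->.
rewrite leq_eqVlt ltnS => /orP[/eqP -> //|/IH].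
exact: leq_trans (row_lengthS _).
Qed.

Lemma row_length_out : row_length j.+1 = 0%N.
Proof. by apply/eqP; rewrite -leqn0 (leq_trans (row_length_le _)) ?subnn. Qed.

Lemma row_count_ex : exists r, row_length r == 0%N.
Proof. by exists j.+1; rewrite row_length_out. Qed.

Definition row_count := ex_minn row_count_ex.

Lemma ltn_row_count r : (r < row_count)%N = (0 < row_length r)%N.
Proof.
rewrite /row_count; case: ex_minnP => s /eqP s0 smin; rewrite lt0n.
apply/idP/idP => [rs|]; first by apply: contraTN rs => /smin; rewrite leqNgt.
apply: contraNT; rewrite -leqNgt => /row_length_mono.
by rewrite s0 leqn0.
Qed.

Definition rows := mkseq row_length row_count.

Lemma size_rows : size rows = row_count.
Proof. exact: size_mkseq. Qed.

Lemma nth_rows r : nth 0%N rows r = row_length r.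
Proof.
have [rs|rs] := ltnP r row_count; first by rewrite nth_mkseq.
rewrite nth_default ?size_rows //; apply/esym/eqP.
by rewrite -leqn0 leqNgt -ltn_row_count -leqNgt.
Qed.

Lemma rows_partition : is_partition rows.
Proof.
apply/andP; split.
  apply/(sortedP 0%N) => i _; rewrite !nth_rows; exact: row_lengthS.
by apply/(all_nthP 0%N) => i; rewrite size_rows nth_rows ltn_row_count.
Qed.

Lemma row_length_sym r : (r < row_count)%N ->
  row_length (j.+1 - r - row_length r) = row_length r.
Proof.
rewrite ltn_row_count => p_gt0; set n := (j.+1 - r - row_length r)%N.
have ple := row_length_le r.
have nr : (n + r + row_length r = j.+1)%N.
  by rewrite /n; lia.
have rn : orth r n by apply: orth_row_length.
have rn' : ~~ orth r n.+1.
  apply/negP => rn'; have: (row_length r <= (row_length r).-1)%N; last by lia.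
  by apply: row_length_min; apply: orthW rn'; rewrite /n; lia.
have jnp p : (j.+1 - n - p = r + row_length r - p)%N by rewrite -nr -addnA addKn.
apply/eqP; rewrite eqn_leq; apply/andP; split.
  by apply: row_length_min; rewrite jnp addnK; apply: orth_sym.
rewrite leqNgt; apply/negP => lt; case/negP: (orth_sym_max rn rn').
by apply: orthW (orth_row_length n); rewrite jnp; lia.
Qed.

End Fixed.
End Ideal.
End Duality.

(** * A Jordan basis from the orthogonal polynomials *)

Section JordanType.
Variable K : fieldType.
Local Notation R := {mpoly K[2]}.

Section Basis.
Variables (I : R -> Prop) (j : nat) (phi : {scalar R}).
Hypothesis Iphi : dual_functional I j phi.
Variables (l m : R) (h : 'I_2 -> {poly K}).
Hypothesis lmh : coordinates l m h.
Local Notation L q := (phi (hform l m j q)).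
Local Notation rows := (rows j phi l m).
Local Notation row_length := (row_length j phi l m).

Definition row_poly r : {poly K} := orthopoly j phi l m r (j.+1 - r - row_length r).

Lemma size_row_poly r : size (row_poly r) = r.+1.
Proof. exact: size_orthopoly. Qed.

Lemma monic_row_poly r : row_poly r \is monic.
Proof. exact: monic_orthopoly. Qed.

Definition row_gen (r : nat) : R := hform l m r (row_poly r).

Definition cell := {r : 'I_(size rows) & 'I_(nth 0%N rows r)}.

Definition cell_form (t : cell) : R := l ^+ tagged t * row_gen (tag t).

Lemma cell_formE (t : cell) :
  cell_form t = hform l m (tagged t + tag t) (row_poly (tag t)).
Proof. by rewrite /cell_form /row_gen hform_lpow // size_row_poly. Qed.

Lemma dual_hform_row e r : (r <= e)%N -> (row_length r <= e - r)%N ->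
  I (hform l m e (row_poly r)).
Proof.
move=> re pe; apply/(dual_hform Iphi lmh); first by rewrite size_row_poly.
move=> q sq; apply: orthopolyP; first exact: orth_row_length.
by move: pe re sq; move: (row_length_le j phi l m r); lia.
Qed.

Lemma spanned_hform_row e r : (r <= e)%N -> spanned I cell_form (hform l m e (row_poly r)).
Proof.
move=> re; have [pe|pe] := leqP (row_length r) (e - r).
  exact/spanned_mod/dual_hform_row.
have rs : (r < size rows)%N.
  by rewrite size_rows ltn_row_count (leq_trans _ pe).
have cp : (e - r < nth 0%N rows (Ordinal rs))%N by rewrite nth_rows.
have := (spanned_basis (dual_subspace Iphi) cell_form (existT _ (Ordinal rs) (Ordinal cp))).
by rewrite cell_formE /= subnK.
Qed.

(** In a fixed degree the [row_poly r] are monic of each degree r, so leading terms can be removed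
    one after another. *)
Lemma spanned_cells p : spanned I cell_form p.
Proof.
have hf e : forall n (q : {poly K}), (size q <= n)%N -> (size q <= e.+1)%N ->
    spanned I cell_form (hform l m e q).
  elim=> [|n IH] q sn se.
    move: sn; rewrite size_poly_leq0 => /eqP ->; rewrite linear0.
    exact: (spanned0 (dual_subspace Iphi)).
  have [->|q0] := eqVneq q 0.
    by rewrite linear0; exact: (spanned0 (dual_subspace Iphi)).
  pose r := (size q).-1; pose a := lead_coef q.
  have sq : size q = r.+1 by rewrite prednK // size_poly_gt0.
  have sq' : (size (q - a *: row_poly r)%R <= r)%N.
    apply/leq_sizeP => i; rewrite leq_eqVlt => /orP[/eqP<-|ri].
      rewrite coefB coefZ.
      have := monic_row_poly r; rewrite monicE /lead_coef size_row_poly => /eqP ->.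
      by rewrite mulr1 /a lead_coefE subrr.
    by rewrite coefB coefZ !nth_default ?size_row_poly ?sq ?mulr0 ?subrr.
  have -> : hform l m e q =
      hform l m e (q - a *: row_poly r) + a *: hform l m e (row_poly r).
    by rewrite -linearZ -linearD /= subrK.
  apply: (spannedD (dual_subspace Iphi)).
    apply: IH; apply: (leq_trans sq'); first by rewrite -ltnS -sq.
    by rewrite ltnW // -sq.
  by apply/(spannedZ (dual_subspace Iphi))/spanned_hform_row; rewrite -ltnS -sq.
rewrite [p](homog_sumE p); apply: (spanned_sum (dual_subspace Iphi)) => e _.
have hp : pihomog mdeg e p \is e.-homog by apply: pihomogP.
rewrite -(hform_dehom lmh hp); apply: hf (leqnn _) _.
exact: (size_dehom lmh hp).
Qed.

(** I is homogeneous, so a relation can be cut down to one degree e. If r is the last row occurring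
    in it with a nonzero coefficient, it yields a form of degree e in I given by a polynomial of
    degree r. Then p_r <= e - r, although row r has a cell of degree e. *)
Lemma cell_free (c : cell -> K) :
  I (\sum_t c t *: cell_form t) -> forall t, c t = 0.
Proof.
move=> Ic t0; apply/eqP; apply: contraT => ct0.
pose deg (t : cell) := (tagged t + tag t)%N; pose e := deg t0.
pose A (t : cell) := (deg t == e) && (c t != 0).
have At0 : A t0 by rewrite /A eqxx.
case: (arg_maxnP (fun t : cell => nat_of_ord (tag t)) At0) => t1 /andP[/eqP d1 c1] max1.
pose q := \sum_(t | A t) c t *: row_poly (tag t).
have Iq : I (hform l m e q).
  suff -> : hform l m e q = pihomog mdeg e (\sum_t c t *: cell_form t).
    exact: (dual_ideal_pihomog Iphi).
  rewrite !linear_sum /= big_mkcond /=; apply: eq_bigr => t _.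
  rewrite !linearZ /= cell_formE /A; have hdt := hform_homog lmh (deg t) (row_poly (tag t)).
  case: eqP => [de|/eqP de] /=.
    rewrite -/(deg t) de in hdt *; rewrite pihomog_dE //.
    by case: eqP => [->|//]; rewrite scale0r.
  by rewrite (pihomog_ne0 de hdt) scaler0.
set r := nat_of_ord (tag t1).
have qE : q = c t1 *: row_poly r + \sum_(t | A t && (t != t1)) c t *: row_poly (tag t).
  by rewrite /q (bigD1 t1) // /A d1 eqxx c1.
have srest : (size (\sum_(t | A t && (t != t1)) c t *: row_poly (tag t))%R <= r)%N.
  apply: (leq_trans (size_sum _ _ _)); apply/bigmax_leqP => t /andP[At tt1].
  apply: (leq_trans (size_scale_leq _ _)); rewrite size_row_poly.
  have : (tag t <= r)%N by exact: max1.
  (* Cells of the same degree in the same row coincide, so all other terms come from earlier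
     rows. *)
  rewrite leq_eqVlt => /orP[/eqP tr|//]; case/negP: tt1.
  have tg : nat_of_ord (tagged t) = tagged t1.
    case/andP: At => /eqP; rewrite -d1 /deg -/r => E _.
    by apply: (@addIn r); rewrite -E; congr (_ + _)%N; apply/esym.
  case: t t1 @r tr tg {d1 c1 max1 qE At} => [a b] [a' b'] /= /val_inj aa.
  by case: a' / aa b' => b' /val_inj ->.
have re : (r <= e)%N by rewrite -d1 leq_addl.
have sq : size q = r.+1.
  by rewrite qE size_polyDl size_scale // ?size_row_poly // ltnS.
have : (row_length r <= tagged t1)%N.
  have := row_length_hform Iphi lmh sq re Iq.
  by rewrite -[X in (X - r)%N]d1 /deg -/r addnK.
by rewrite -nth_rows leqNgt ltn_ord.
Qed.

Lemma jordan_type_rows : jordan_type I l rows.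
Proof.
split; first exact: rows_partition.
exists (fun r => row_gen r); split.
  split=> // [|f _]; first exact: cell_free.
  exact: spanned_cells.
move=> r; rewrite /row_gen hform_lpow ?size_row_poly // nth_rows //.
by apply: dual_hform_row; rewrite ?leq_addl // addnK.
Qed.

Lemma rows_symmetric : symmetric_partition j rows.
Proof.
split=> [|r]; first exact: rows_partition.
rewrite size_rows !nth_rows // => rs; rewrite row_length_sym //; split=> //.
by have := row_length_le j phi l m r; move: rs; rewrite ltn_row_count; lia.
Qed.

End Basis.
End JordanType.

(** * Differential duality and Hessians *)

Section DifferentialDuality.
Variable K : fieldType.
Hypothesis char0 : [pchar K] =i pred0.
Local Notation R := {mpoly K[2]}.

Lemma natf_neq0 n : (n != 0)%N -> n%:R != 0 :> K.
Proof. by rewrite ((pcharf0P K).1 char0). Qed.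

Definition diff_functional (F f : R) : K := (apply_diff f F)@_0.

Lemma diff_functional_is_scalar F : scalar (diff_functional F).
Proof.
by move=> c f g; rewrite /diff_functional apply_diffD apply_diffZ mcoeffD mcoeffZ.
Qed.

HB.instance Definition _ F := GRing.isLinear.Build K R K *%R (diff_functional F)
  (diff_functional_is_scalar F).

Definition mnm_fact (m : 'X_{1..2}) : nat := (\prod_(i < 2) (m i)`!)%N.

Lemma mnm_fact_neq0 m : (mnm_fact m)%:R != 0 :> K.
Proof. by apply: natf_neq0; rewrite -lt0n prodn_gt0 // => i; apply: fact_gt0. Qed.

Lemma diff_functionalX F m : diff_functional F 'X_[m] = F@_m * (mnm_fact m)%:R.
Proof.
rewrite /diff_functional apply_diffX mcoeff_mderivm addm0 mulr_natr.
by congr (_ *+ _); apply: eq_bigr => i _; rewrite ffactnn.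
Qed.

(** Applying X^m and taking the constant term reads off the coefficient at m times a product of
    factorials, which is invertible in characteristic 0. *)
Lemma AnnP F f : Ann F f <-> forall g, diff_functional F (g * f) = 0.
Proof.
rewrite /Ann /diff_functional; split=> [fF g|H].
  by rewrite apply_diffM fF apply_diff_r0 mcoeff0.
apply/mpolyP => m; have := H 'X_[m]; rewrite apply_diffM.
rewrite -/(diff_functional _ _) diff_functionalX mcoeff0 => /eqP.
by rewrite mulf_eq0 (negbTE (mnm_fact_neq0 m)) orbF => /eqP.
Qed.

Lemma Ann_dual_functional j F : F \is j.-homog ->
  dual_functional (Ann F) j (diff_functional F).
Proof.
move=> hF; split=> [e p hp ej|p]; last exact: AnnP.
rewrite [p]mpolyE linear_sum big_seq big1 //= => m mp.
rewrite linearZ /= diff_functionalX (dhomog_nemf_coeff hF) ?mul0r ?mulr0 //=.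
by rewrite (dhomog_mf hp mp).
Qed.

(** The inverse system: the coefficient of F at m is phi(X^m) divided by the factorials of m. *)
Lemma dual_functional_Ann I j phi : dual_functional I j phi ->
  exists2 F : R, F \is j.-homog & forall p, Ann F p <-> I p.
Proof.
move=> [deg IP].
pose E (m : 'X_{1..2}) : K := if mdeg m == j then phi 'X_[m] / (mnm_fact m)%:R else 0.
pose F : R := \sum_(m : 'X_{1..2 < j.+1}) E m *: 'X_[m].
have FE m : F@_m = E m.
  have [mj|jm] := leqP (mdeg m) j; first by rewrite mcoeff_mpoly.
  rewrite /E gtn_eqF // raddf_sum big1 // => m' _ /=.
  rewrite mcoeffZ mcoeffX; case: eqP => [mm'|_]; last by rewrite mulr0.
  by have := bmdeg m'; rewrite mm' ltnS leqNgt jm.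
have hF : F \is j.-homog.
  apply/dhomogP => m; rewrite mcoeff_msupp FE /E; case: (mdeg m =P j) => // _.
  by rewrite eqxx.
exists F => // p; rewrite AnnP IP.
have phiE q : diff_functional F q = phi q.
  rewrite [q]mpolyE !linear_sum; apply: eq_bigr => m _ /=.
  rewrite !linearZ /= diff_functionalX FE /E; congr (_ * _).
  case: eqP => [_|/eqP mj]; first by rewrite divfK ?mnm_fact_neq0.
  by rewrite mul0r (deg (mdeg m)) // dhomogX.
by split=> H g; have := H g; rewrite phiE.
Qed.

Lemma apply_diff_homog e e' (p F : R) :
  p \is e.-homog -> F \is (e + e').-homog -> apply_diff p F \is e'.-homog.
Proof.
move=> hp hF; rewrite /apply_diff big_seq; apply: rpred_sum => m mp.
apply/rpredZ/dhomogP => m'; rewrite mcoeff_msupp mcoeff_mderivm => ne0.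
have := dhomog_mf hp mp; have : (m + m')%MM \in msupp F.
  by rewrite mcoeff_msupp; apply: contraNneq ne0 => ->; rewrite mul0rn.
by move/(dhomog_mf hF); rewrite /= mdegD => E1 E2; move: E1; rewrite E2 => /addnI.
Qed.

Lemma euler_homog e (G : R) (v : 'I_2 -> K) : G \is e.-homog ->
  \sum_i v i * (G^`M(i)).@[v] = e%:R * G.@[v].
Proof.
move=> hG; rewrite [in RHS](mpolyE G) [in RHS]raddf_sum mulr_sumr /=.
transitivity (\sum_i \sum_(m <- msupp G) v i * (G@_m * ((m i)%:R * 'X_[(m - U_(i))%MM].@[v]))).
  apply: eq_bigr => i _; rewrite /mderiv raddf_sum mulr_sumr /=.
  by apply: eq_bigr => m _; rewrite mevalZ mulrA [_ * G@__]mulrC mulrA.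
rewrite exchange_big /= !big_seq; apply: eq_bigr => m mG.
rewrite mevalZ -(dhomog_mf hG mG) /= mdegE natr_sum mulr_suml.
apply: eq_bigr => i _; rewrite mulrCA [RHS]mulrCA; congr (_ * _).
rewrite mulrCA; have [->|mi] := eqVneq (m i) 0%N; first by rewrite !mul0r.
congr (_ * _); rewrite -{1}(mevalXU v i) -mevalM -mpolyXD addmC submK //.
by apply/mnm_lepP => t; rewrite mnm1E; case: eqP => // <-; rewrite lt0n.
Qed.

Lemma apply_diff1 (G : R) : apply_diff 1 G = G.
Proof. by rewrite -mpolyX0 apply_diffX mderivm0m. Qed.

Lemma ord2_sum (T : nmodType) (f : 'I_2 -> T) : \sum_i f i = f ord0 + f ord_max.
Proof. by rewrite big_ord_recl big_ord1; congr (_ + f _); apply: val_inj. Qed.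

Lemma homog0_const (p : R) : p \is 0.-homog -> p = (p@_0)%:MP.
Proof.
move=> hp; apply/mpolyP => mu; rewrite mcoeffC.
have [->|mu0] := eqVneq mu 0%MM; first by rewrite mulr1.
by rewrite mulr0 (dhomog_nemf_coeff hp) //= mdeg_eq0.
Qed.

(** Each factor l differentiates in the direction (a, b), and Euler's identity supplies the factors
    of e!. This turns evaluation at l into a value of the dual functional. *)
Lemma linear_power_diff e (G l : R) : l \is 1.-homog -> G \is e.-homog ->
  (apply_diff (l ^+ e) G)@_0 = (e`!)%:R * G.@[coefs l].
Proof.
move=> hl; elim: e G => [|e IH] G hG.
  rewrite expr0 apply_diff1 mul1r.
  by rewrite (homog0_const hG) mevalC mcoeffC eqxx mulr1.
rewrite exprSr apply_diffM IH; last by apply: (apply_diff_homog hl).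
rewrite factS mulnC natrM -mulrA -(euler_homog _ hG) ord2_sum; congr (_ * _).
rewrite [X in apply_diff X _](linear_formE hl) apply_diffD !apply_diffZ !apply_diffX !mderivmU1m.
by rewrite mevalD !mevalZ.
Qed.

(** A kernel vector is the coefficient vector of a polynomial of some degree r <= i that is
    orthogonal to all degrees up to i. *)
Lemma det_hankel_eq0 j (phi : {scalar R}) (l m : R) i :
  \det (hankel j phi l m i.+1 i.+1) = 0 <->
  exists2 r, (r <= i)%N & orth j phi l m r i.+1.
Proof.
split=> [/eqP/det0P[w w0 wH]|[r ri ro]].
  pose q := \sum_(u < i.+1) w ord0 u *: 'X^u : {poly K}.
  have qE (u : 'I_i.+1) : q`_u = w ord0 u by apply: coef_sum_Xn.
  have q0 : q != 0.
    apply: contraNneq w0 => q0; apply/eqP/rowP => u.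
    by rewrite -qE q0 coef0 mxE.
  have sq : (size q <= i.+1)%N by apply: size_sum_Xn.
  have sqE : size q = (size q).-1.+1 by rewrite prednK // size_poly_gt0.
  exists (size q).-1; first by rewrite -ltnS -sqE.
  apply: (orth_of_size sqE) => v vi.
  rewrite mulrC (functional_coef_sum _ _ _ _ _ sq).
  move/rowP/(_ (Ordinal vi)): wH; rewrite !mxE => wH; rewrite -[RHS]wH.
  by apply: eq_bigr => u _; rewrite qE mxE -exprD addnC.
apply/eqP/det0P; pose Y := orthopoly j phi l m r i.+1.
have sY : size Y = r.+1 by apply: size_orthopoly.
exists (\row_u Y`_u).
  apply/eqP => /rowP/(_ (Ordinal (ri : r < i.+1)%N)); rewrite !mxE /= => Yr.
  have := monic_orthopoly j phi l m r i.+1.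
  by rewrite monicE /lead_coef -/Y sY /= Yr eq_sym oner_eq0.
apply/rowP => v; rewrite !mxE.
have := orthopolyP ro (_ : size 'X^v <= i.+1)%N; rewrite size_polyXn => /(_ (ltn_ord v)).
rewrite mulrC (functional_coef_sum _ _ _ _ _ (_ : (size Y <= i.+1)%N)) ?sY // => H.
rewrite -[RHS]H; apply: eq_bigr => u _.
by rewrite !mxE -exprD addnC.
Qed.

Section Hessian.
Variables (F : R) (j : nat) (l m : R) (h : 'I_2 -> {poly K}).
Hypotheses (hF : F \is j.-homog) (lmh : coordinates l m h).
Local Notation phi := (diff_functional F).
Local Notation rows := (rows j phi l m).
Local Notation row_length := (row_length j phi l m).
Let dualF := Ann_dual_functional hF.

(** The hypothesis says that the strings of all rows r <= i reach degree i, so no nonzero form of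
    degree i lies in the annihilator. *)
Lemma forms_basis i : (forall r, r <= i -> i < r + row_length r)%N ->
  basis_mod (Ann F) (@forms K i) (fun u : 'I_i.+1 => hform l m i 'X^u).
Proof.
move=> full; split=> [u|c Ic|f fi].
- exact: (hform_homog lmh).
- pose q := \sum_(u < i.+1) c u *: 'X^u : {poly K}.
  have sq : (size q <= i.+1)%N by apply: size_sum_Xn.
  have qE : hform l m i q = \sum_u c u *: hform l m i 'X^u.
    by rewrite linear_sum; apply: eq_bigr => u _; rewrite linearZ.
  rewrite -qE in Ic.
  have q0 : q = 0.
    apply/eqP; apply: contraT => q0.
    have sqE : size q = (size q).-1.+1 by rewrite prednK // size_poly_gt0.
    have ri : ((size q).-1 <= i)%N by rewrite -ltnS -sqE.
    have := full _ ri; rewrite ltnNge => /negP[].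
    by have := row_length_hform dualF lmh sqE ri Ic; move: ri; lia.
  by move=> u; rewrite -(coef_sum_Xn c u) -/q q0 coef0.
- exists (fun u : 'I_i.+1 => (dehom h f)`_u).
  suff -> : \sum_(u < i.+1) (dehom h f)`_u *: hform l m i 'X^u = f.
    by rewrite subrr; apply: (dual_ideal0 dualF).
  rewrite -[RHS](hform_dehom lmh fi) [in RHS](poly_sum_le (size_dehom lmh fi)).
  by rewrite linear_sum; apply: eq_bigr => u _; rewrite linearZ.
Qed.

(** For the basis l^(i-u) m^u the entries are forms of degree e = j - 2 i, and their values at l are
    Hankel entries divided by e!. The determinant vanishes iff s(r) > i for some r <= i. *)
Lemma hess_vanishes_boundary i : (i + i <= j)%N ->
  (forall r, r <= i -> i < r + row_length r)%N ->
  hess_vanishes F i l <-> ~~ boundary j rows i.+1.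
Proof.
move=> ij full; rewrite (hess_vanishesP l (forms_basis full)).
have hl : l \is 1.-homog by case: lmh.
set e := (j - (i + i))%N; have eE : (e + (i + i) = j)%N by rewrite subnK.
have e0 : (e`!)%:R != 0 :> K by apply: natf_neq0; rewrite -lt0n fact_gt0.
have -> : (hessian (fun u : 'I_i.+1 => hform l m i 'X^u) F).@[coefs l] =
    \det ((e`!)%:R^-1 *: hankel j phi l m i.+1 i.+1).
  rewrite /hessian -det_map_mx; congr (\det _).
  apply/matrixP => u v; rewrite !mxE.
  have sX (w : 'I_i.+1) : (size ('X^w : {poly K}) <= i.+1)%N.
    by rewrite size_polyXn.
  have hh : apply_diff (hform l m i 'X^u * hform l m i 'X^v) F \is e.-homog.
    apply: (@apply_diff_homog (i + i)); last by rewrite addnC eE.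
    exact: dhomogM (hform_homog lmh _ _) (hform_homog lmh _ _).
  apply: (mulfI e0); rewrite mulrA mulfV // mul1r -(linear_power_diff hl hh).
  rewrite -apply_diffM -/(diff_functional _ _) (hformM lmh) // -exprD.
  rewrite hform_lpow ?eE // size_polyXn; move: (ltn_ord u) (ltn_ord v); lia.
rewrite detZ; split=> [/eqP|nb].
  rewrite mulf_eq0 expf_eq0 invr_eq0 (negbTE e0) andbF /= => /eqP.
  move/det_hankel_eq0 => [r ri ro]; apply/negP => /boundaryP[_ /(_ r ri)].
  rewrite nth_rows.
  suff : (row_length r <= j - r - i)%N by lia.
  by apply: row_length_min; apply: orthW ro; lia.
suff -> : \det (hankel j phi l m i.+1 i.+1) = 0 by rewrite mulr0.
apply/det_hankel_eq0; have : [exists r : 'I_i.+1, r + row_length r + i <= j]%N.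
  apply: contraT => /existsPn H; case/negP: nb; apply/boundaryP; split.
    by rewrite size_rows ltn_row_count; have := full i (leqnn i); lia.
  by move=> r ri; rewrite nth_rows; have := H (Ordinal ri); rewrite /=; lia.
case/existsP=> r rP; exists r; first by rewrite -ltnS.
by apply: orthW (orth_row_length j phi l m r); lia.
Qed.

End Hessian.
End DifferentialDuality.

(** * Complete intersections *)

Section CompleteIntersections.
Variable K : fieldType.
Local Notation R := {mpoly K[2]}.

Lemma pihomogM s e (u f : R) : f \is s.-homog ->
  pihomog mdeg e (u * f) = if (s <= e)%N then pihomog mdeg (e - s) u * f else 0.
Proof.
move=> hf; rewrite {1}(homog_sumE u) mulr_suml linear_sum /=.
have hd d : pihomog mdeg d u * f \is (d + s).-homog.
  by apply: dhomogM => //; apply: pihomogP.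
have zero d : (d + s)%N != e -> pihomog mdeg e (pihomog mdeg d u * f) = 0.
  by move=> ne; apply: pihomog_ne0 ne (hd d).
case: leqP => [ae|ea]; last by rewrite big1 // => d _; apply: zero; lia.
have [lt|ge] := ltnP (e - s) (msize u).
  rewrite (bigD1 (Ordinal lt)) //= big1 ?addr0.
    by apply: pihomog_dE; rewrite -{2}(subnK ae).
  move=> d ne; apply: zero; apply: contraNneq ne => E.
  by apply/eqP/val_inj; rewrite /=; lia.
rewrite big1 => [|d _]; last by apply: zero; have := ltn_ord d; lia.
rewrite [pihomog _ _ u]pihomogE big_seq_cond big1 ?mul0r // => mu /andP[mup /eqP mue].
by have := msize_mdeg_lt mup; rewrite mue ltnNge ge.
Qed.

Lemma ideal2_homog_pihomog s t e (f g p : R) : f \is s.-homog -> g \is t.-homog ->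
  ideal2 f g p -> ideal2 f g (pihomog mdeg e p).
Proof.
move=> hf hg [u [v ->]]; rewrite linearD /= !(pihomogM _ _ hf, pihomogM _ _ hg).
exists (if (s <= e)%N then pihomog mdeg (e - s) u else 0).
exists (if (t <= e)%N then pihomog mdeg (e - t) v else 0).
by do 2!case: ifP => _; rewrite ?mul0r.
Qed.

Lemma ideal2_sum (f g : R) (T : Type) (r : seq T) (F : T -> R) :
  (forall i, ideal2 f g (F i)) -> ideal2 f g (\sum_(i <- r) F i).
Proof.
move=> H; apply: (big_ind (ideal2 f g)) => // [|_ _ [u [v ->]] [u' [v' ->]]].
  by exists 0, 0; rewrite !mul0r addr0.
by exists (u + u'), (v + v'); rewrite !mulrDl addrACA.
Qed.

Lemma homog_coef0 e (p : R) : p \is e.-homog -> (0 < e)%N -> p@_0 = 0.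
Proof.
by move=> hp e0; apply: (dhomog_nemf_coeff hp); rewrite /= mdeg0 neq_ltn e0.
Qed.

Lemma mcoeff0_mul (p q : R) : (p * q)@_0 = p@_0 * q@_0.
Proof. exact: (rmorphM (mcoeff 0)). Qed.

Lemma dual_functional_ext (I I' : R -> Prop) j phi :
  (forall p, I' p <-> I p) -> dual_functional I j phi -> dual_functional I' j phi.
Proof. by move=> E [deg IP]; split=> // p; rewrite E. Qed.

Section Coordinates.
Variables (l m : R) (h : 'I_2 -> {poly K}).
Hypothesis lmh : coordinates l m h.

Lemma hformM_sub s e (u f0 : {poly K}) : (size u <= e.+1 - s)%N ->
  (size f0 <= s.+1)%N -> hform l m e (u * f0) = hform l m (e - s) u * hform l m s f0.
Proof.
move=> su sf; have [ae|ea] := leqP s e.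
  by rewrite (hformM lmh) ?subnK // -subSn.
have -> : u = 0 by apply/eqP; rewrite -size_poly_leq0; lia.
by rewrite mul0r !linear0 mul0r.
Qed.

Section Pair.
Variables (s t : nat) (f0 g0 : {poly K}).
Hypotheses (sf0 : size f0 = s.+1) (sg0 : (size g0 <= t.+1)%N).
Variables w1 w2 : {poly K}.
Hypotheses (bez : w1 * f0 + w2 * g0 = 1) (s0 : (0 < s)%N) (t0 : (0 < t)%N).
Local Notation f := (hform l m s f0).
Local Notation g := (hform l m t g0).

Lemma f0_neq0 : f0 != 0.
Proof. by rewrite -size_poly_eq0 sf0. Qed.

(** The cofactors are replaced by their components of degrees e - s and e - t, or by 0 if that
    degree is negative. *)
Lemma ideal2_hform_decomp e (q : {poly K}) : (size q <= e.+1)%N ->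
  ideal2 f g (hform l m e q) -> exists u v : {poly K},
    [/\ q = u * f0 + v * g0, (size u <= e.+1 - s)%N & (size v <= e.+1 - t)%N].
Proof.
move=> sq [u [v E]]; have hf := hform_homog lmh s f0; have hg := hform_homog lmh t g0.
have := congr1 (pihomog mdeg e) E.
rewrite linearD /= (pihomogM _ _ hf) (pihomogM _ _ hg) (pihomog_dE (hform_homog lmh e q)).
pose comp c w : {poly K} := if (c <= e)%N then dehom h (pihomog mdeg (e - c) w) else 0.
have scomp c w : (size (comp c w) <= e.+1 - c)%N.
  rewrite /comp; case: (leqP c e) => ce; last by rewrite size_poly0.
  by rewrite subSn // (size_dehom lmh) // pihomogP.
move/(congr1 (dehom h)); rewrite (dehom_hform lmh sq) rmorphD /= => qE.
exists (comp s u), (comp t v); split=> //; rewrite qE /comp.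
by congr (_ + _); case: ifP => _; rewrite ?rmorph0 ?mul0r // rmorphM /= dehom_hform ?sf0.
Qed.

Lemma ideal2_hform_intro e (u v : {poly K}) :
  (size u <= e.+1 - s)%N -> (size v <= e.+1 - t)%N ->
  ideal2 f g (hform l m e (u * f0 + v * g0)).
Proof.
move=> su sv; exists (hform l m (e - s) u), (hform l m (e - t) v).
by rewrite linearD /= (@hformM_sub s) ?sf0 // (@hformM_sub t).
Qed.

(* By bez, w2 is the inverse of g0 modulo f0, so this is q / g0 modulo f0: the
   form of degree e with dehomogenization q is in (f, g) iff it is small, and the
   functional dual to (f, g) reads off its top coefficient. *)
Definition quotient_mod (q : {poly K}) : {poly K} := (q * w2) %% f0.

Lemma quotient_mod_is_linear : linear quotient_mod.
Proof.
by move=> c p q; rewrite /quotient_mod mulrDl modpD -scalerAl modpZl.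
Qed.

HB.instance Definition _ :=
  GRing.isLinear.Build K {poly K} {poly K} _ quotient_mod quotient_mod_is_linear.

Lemma quotient_mod_comb u v : quotient_mod (u * f0 + v * g0) = v %% f0.
Proof.
have gE : w2 * g0 = 1 - w1 * f0 by rewrite -bez addrAC subrr add0r.
have -> : quotient_mod (u * f0 + v * g0) = (v + (u * w2 - v * w1) * f0) %% f0.
  rewrite /quotient_mod; congr (_ %% _).
  transitivity (u * w2 * f0 + v * (w2 * g0)); first by ring.
  by rewrite gE; ring.
by rewrite modpD modp_mull addr0.
Qed.

Lemma quotient_mod_mul q p : quotient_mod (q * p) = (q * quotient_mod p) %% f0.
Proof. by rewrite /quotient_mod modp_mul mulrA. Qed.

(** The residue v serves as cofactor of g0. If its degree is at most e - t, then q - v g0 is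
    divisible by f0 and of degree at most e; as f0 has full degree s, the other cofactor has degree
    at most e - s. *)
Lemma ideal2_hform e (q : {poly K}) : (size q <= e.+1)%N ->
  ideal2 f g (hform l m e q) <-> (size (quotient_mod q) <= e.+1 - t)%N.
Proof.
move=> sq; split=> [/(ideal2_hform_decomp sq)[u [v [-> _ sv]]]|sv].
  by rewrite quotient_mod_comb (leq_trans (leq_modp _ _)).
set v := quotient_mod q in sv.
have f0q : f0 %| q - v * g0.
  have vE : v = q * w2 - (q * w2) %/ f0 * f0.
    by rewrite {1}(divp_eq (q * w2) f0) addrAC subrr add0r.
  have -> : q - v * g0 = (q * w1 + (q * w2) %/ f0 * g0) * f0.
    by rewrite vE -[q in X in X - _]mulr1 -bez; ring.
  exact: dvdp_mull.
rewrite -(subrK (v * g0) q) -(divpK f0q); apply: ideal2_hform_intro => //.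
rewrite size_divp ?f0_neq0 // sf0 /= leq_sub2r //.
apply: (leq_trans (size_polyD _ _)); rewrite size_polyN geq_max sq /=.
have [->|v0] := eqVneq v 0; first by rewrite mul0r size_poly0.
apply: (leq_trans (size_polyMleq _ _)); move: sv sg0.
by rewrite -size_poly_gt0 in v0; lia.
Qed.

(** In degree s + t - 2 membership means that the residue has size at most s - 1, that is, its
    coefficient at X^(s-1) vanishes. *)
Definition ci_functional (p : R) : K :=
  (quotient_mod (dehom h (pihomog mdeg (s + t - 2) p)))`_s.-1.

Lemma ci_functional_is_scalar : scalar ci_functional.
Proof.
move=> c p q; rewrite /ci_functional linearD linearZ /= rmorphD /= dehomZ.
by rewrite linearD linearZ /= coefD coefZ.
Qed.

HB.instance Definition _ := GRing.isLinear.Build K R K *%R ci_functional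
  ci_functional_is_scalar.

Lemma size_quotient_mod q : (size (quotient_mod q) <= s)%N.
Proof. by rewrite -ltnS -sf0 ltn_modp f0_neq0. Qed.

Lemma ci_dual_functional : dual_functional (ideal2 f g) (s + t - 2) ci_functional.
Proof.
have hf := hform_homog lmh s f0; have hg := hform_homog lmh t g0.
have phiE w : (ci_functional : {scalar R}) w =
  (quotient_mod (dehom h (pihomog mdeg (s + t - 2) w)))`_s.-1 by [].
split=> [e p hp ej|p].
  by rewrite phiE (pihomog_ne0 ej hp) rmorph0 linear0 coef0.
split=> [Ip q|H].
  have Iqp : ideal2 f g (q * p).
    by case: Ip => u [v ->]; exists (q * u), (q * v); rewrite mulrDr !mulrA.
  have hqp : pihomog mdeg (s + t - 2) (q * p) \is (s + t - 2).-homog.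
    exact: pihomogP.
  have := ideal2_homog_pihomog (s + t - 2) hf hg Iqp.
  rewrite -(hform_dehom lmh hqp) ideal2_hform ?(size_dehom lmh hqp) // => sq.
  by rewrite phiE nth_default // (leq_trans sq) //; lia.
rewrite (homog_sumE p); apply: ideal2_sum => e.
have hpe : pihomog mdeg e p \is e.-homog by apply: pihomogP.
rewrite -(hform_dehom lmh hpe); set q := dehom h _.
have sq : (size q <= e.+1)%N by apply: (size_dehom lmh hpe).
rewrite ideal2_hform // leqNgt; apply/negP => lt.
set v := quotient_mod q in lt; have sv : (size v <= s)%N by apply: size_quotient_mod.
have ej : (e <= s + t - 2)%N by lia.
(* If the residue v is too large, this multiplier lifts its leading term to X^(s-1) without any
   reduction modulo f0, so the functional takes the value [lead_coef v]. *)
pose q' : {poly K} := 'X^(s - size v).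
have sq' : (size q' <= (s + t - 2 - e).+1)%N by rewrite size_polyXn; lia.
have := H (hform l m (s + t - 2 - e) q').
rewrite phiE mulrC (pihomogM _ _ (hform_homog lmh _ _)) leq_subr subKn //.
rewrite -(hform_dehom lmh hpe) -/q (hformM lmh) // subnKC // (dehom_hform lmh); last first.
  have [->|q0] := eqVneq q 0; first by rewrite mul0r size_poly0.
  by apply: (leq_trans (size_polyMleq _ _)); rewrite size_polyXn; move: sq; lia.
have v0 : v != 0 by rewrite -size_poly_gt0; lia.
rewrite mulrC quotient_mod_mul -/v mulrC modp_small; last first.
  by rewrite size_mulXn // sf0 subnK.
rewrite coefMXn ltnNge (_ : (s - size v <= s.-1)%N) /=; last first.
  by rewrite -subn1 leq_sub2l // size_poly_gt0.
have -> : (s.-1 - (s - size v) = (size v).-1)%N.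
  by rewrite -size_poly_gt0 in v0; move: v0 sv; move: (size v) => n; lia.
by rewrite -lead_coefE => /eqP; rewrite lead_coef_eq0 (negbTE v0).
Qed.

End Pair.
End Coordinates.
End CompleteIntersections.

(** * The functional dual to an arbitrary complete intersection *)

Section DualOfCompleteIntersection.
Variable K : fieldType.
Local Notation R := {mpoly K[2]}.

(** From F1 g = G1 f regularity gives F1 = q f = q F1 w, hence q w = 1, which is impossible in
    positive degree. *)
Lemma regular_no_common_factor (f g F1 G1 w : R) e :
  regular_sequence2 f g -> w \is e.-homog -> (0 < e)%N ->
  f = F1 * w -> g = G1 * w -> False.
Proof.
move=> [freg fg _] hw e0 fE gE.
have [q F1E] : exists q, F1 = q * f by apply: fg; exists G1; rewrite fE gE; ring.
have f0 : f != 0.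
  apply/eqP => f0; have := freg 1; rewrite f0 mulr0 => /(_ erefl) /eqP.
  by rewrite oner_eq0.
have F10 : F1 != 0 by apply: contraNneq f0 => F10; rewrite fE F10 mul0r.
have qw : q * w = 1.
  by apply: (mulfI F10); rewrite mulr1 {2}F1E fE; ring.
have := congr1 (mcoeff 0%MM) qw.
rewrite mcoeff0_mul (homog_coef0 hw e0) mulr0 mcoeff1 eqxx => /eqP.
by rewrite eq_sym oner_eq0.
Qed.

Lemma ideal2_unit (f g : R) (c : K) : c != 0 -> ideal2 f g c%:MP -> ideal2 f g 1.
Proof.
move=> c0 [u [v E]]; exists (c^-1 *: u), (c^-1 *: v).
by rewrite -!scalerAl -scalerDr -E -mul_mpolyC -mpolyCM mulVf.
Qed.

Lemma ideal2C (f g p : R) : ideal2 g f p <-> ideal2 f g p.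
Proof. by split=> -[u [v ->]]; exists v, u; rewrite addrC. Qed.

(** A generator of degree 0 is zero, against regularity, or a unit, against properness. *)
Lemma regular_degrees_gt0 s t (f g : R) : regular_sequence2 f g ->
  f \is s.-homog -> g \is t.-homog -> (0 < s)%N /\ (0 < t)%N.
Proof.
move=> [freg fg no1] hf hg; split; rewrite lt0n; apply/eqP => d0.
  rewrite d0 in hf; case: no1; have fE := homog0_const hf.
  have [c0|c0] := eqVneq (f@_0) 0.
    have := freg 1; rewrite fE c0 mulr0 => /(_ erefl) /eqP.
    by rewrite oner_eq0.
  by apply: (ideal2_unit c0); exists 1, 0; rewrite -fE mul1r mul0r addr0.
rewrite d0 in hg; case: (no1); have gE := homog0_const hg.
have [c0|c0] := eqVneq (g@_0) 0.
  have [|q qE] := fg 1; first by exists 0; rewrite gE c0 mulr0 mul0r.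
  by exists q, 0; rewrite qE mul0r addr0.
by apply: (ideal2_unit c0); exists 0, 1; rewrite -gE mul1r mul0r add0r.
Qed.

Lemma graded_artinian_ci_dual (I : R -> Prop) : graded_artinian_ci I ->
  exists j (phi : {scalar R}), dual_functional I j phi.
Proof.
move=> [_ [s [t [f [g [hf hg reg IE]]]]]].
have [s0 t0] := regular_degrees_gt0 reg hf hg.
have [m [h lmh]] := coordinates_exist (linear_formX K).
set l := 'X_ord0 in lmh; have hl : l \is 1.-homog by case: lmh.
pose f0 := dehom h f; pose g0 := dehom h g.
have fE : f = hform l m s f0 by rewrite (hform_dehom lmh).
have gE : g = hform l m t g0 by rewrite (hform_dehom lmh).
have sf : (size f0 <= s.+1)%N by apply: (size_dehom lmh).
have sg : (size g0 <= t.+1)%N by apply: (size_dehom lmh).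
have fN0 : f0 != 0.
  apply/eqP => f00; case: reg => /(_ 1); rewrite fE f00 linear0 mulr0 => /(_ erefl) /eqP.
  by rewrite oner_eq0.
have gN0 : g0 != 0.
  apply/eqP => g00; have g_0 : g = 0 by rewrite gE g00 linear0.
  case: reg => _ fg; case.
  have [|q qE] := fg 1; first by exists 0; rewrite g_0 mulr0 mul0r.
  by exists q, 0; rewrite qE mul0r addr0.
(* A common factor of the dehomogenizations would homogenize to a common factor of f and g. *)
have cop : coprimep f0 g0.
  rewrite /coprimep; apply: contraT => sw; set w := gcdp f0 g0 in sw.
  have w0 : w != 0 by rewrite gcdp_eq0 negb_and fN0.
  have sw1 : (1 < size w)%N by move: sw; rewrite -size_poly_gt0 in w0; lia.
  have div (p : {poly K}) c : p != 0 -> w %| p -> (size p <= c.+1)%N ->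
      exists P, hform l m c p = P * hform l m (size w).-1 w.
    move=> p0 wp sp; have pE := divpK wp.
    have q0 : p %/ w != 0 by apply: contraNneq p0 => q0; rewrite -pE q0 mul0r.
    have := size_mul q0 w0; rewrite pE => sE.
    exists (hform l m (c - (size w).-1) (p %/ w)); rewrite -(hformM_sub lmh) ?pE //.
      rewrite -size_poly_gt0 in q0; move: sE sp q0 sw1.
      by move: (size (p %/ w)) (size w) (size p) => x y z; lia.
    by rewrite prednK // ltnW.
  have [F1 F1E] := div f0 s fN0 (dvdp_gcdl _ _) sf.
  have [G1 G1E] := div g0 t gN0 (dvdp_gcdr _ _) sg.
  have e0 : (0 < (size w).-1)%N by lia.
  rewrite -fE in F1E; rewrite -gE in G1E.
  by case: (regular_no_common_factor reg (hform_homog lmh _ _) e0 F1E G1E).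
have [[w1 w2] /= bez] := Bezout_eq1_coprimepP _ _ cop.
have [sf'|sf'] := ltnP s (size f0).
  have sfE : size f0 = s.+1 by apply/eqP; rewrite eqn_leq sf.
  exists (s + t - 2)%N, (ci_functional h s t f0 w2).
  apply: dual_functional_ext (ci_dual_functional lmh sfE sg bez s0 t0) => p.
  by rewrite -fE -gE.
have [sg'|sg'] := ltnP t (size g0).
  have sgE : size g0 = t.+1 by apply/eqP; rewrite eqn_leq sg.
  exists (t + s - 2)%N, (ci_functional h t s g0 w1); rewrite addrC in bez.
  apply: dual_functional_ext (ci_dual_functional lmh sgE sf bez t0 s0) => p.
  by rewrite -fE -gE IE ideal2C.
(* If neither dehomogenization has full degree, then l divides both f and g. *)
have low c (p : {poly K}) : (0 < c)%N -> (size p <= c)%N ->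
    hform l m c p = hform l m c.-1 p * l.
  by case: c => // c _ sp; rewrite hformSl // mulrC.
have fl := low s f0 s0 sf'; have gl := low t g0 t0 sg'.
rewrite -fE in fl; rewrite -gE in gl.
by case: (regular_no_common_factor reg hl (ltnSn 0) fl gl).
Qed.

End DualOfCompleteIntersection.

(** * Continuants *)

Section Continuants.
Variables (K : fieldType) (ns : seq nat).
Hypothesis pos : all (fun n => 0 < n)%N ns.

(* The pairs (h_m, h_(m-1)). For p_m the m-th part size of layered 0 ns, the ideal
   of h_c and l^(p_c) h_(c-1) contains l^(p_(m+1)) h_m for all m < c. *)
Fixpoint continuants (m : nat) : {poly K} * {poly K} :=
  if m is m'.+1 then
    let: (a, b) := continuants m' in ('X^(nth 0%N ns m') * a - b, a)
  else (1, 0).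

Definition continuant m : {poly K} := (continuants m).1.

Lemma continuantsS m : (continuants m.+1).2 = continuant m.
Proof. by rewrite /continuant /=; case: (continuants m). Qed.

Lemma continuantSS m : continuant m.+2 =
  'X^(nth 0%N ns m.+1) * continuant m.+1 - continuant m.
Proof.
have E : continuants m.+2 = ('X^(nth 0%N ns m.+1) * (continuants m.+1).1 -
    (continuants m.+1).2, (continuants m.+1).1).
  by move: (m.+1) => i /=; case: (continuants i).
by rewrite /continuant E /= -/(continuant m) -continuantsS.
Qed.

Lemma psumS m : (m < size ns)%N -> psum ns m.+1 = (psum ns m + nth 0%N ns m)%N.
Proof. by move=> ms; rewrite /psum (take_nth 0%N) // sumn_rcons. Qed.

Lemma psum_ltS m : (m < size ns)%N -> (psum ns m < psum ns m.+1)%N.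
Proof.
move=> ms; rewrite psumS // -[X in (X < _)%N]addn0 ltn_add2l.
by apply: (allP pos); rewrite mem_nth.
Qed.

Lemma continuants_size m : (m <= size ns)%N ->
  [/\ size (continuants m).1 = (psum ns m).+1, (continuants m).1 \is monic
    & (size (continuants m).2 <= psum ns m)%N].
Proof.
elim: m => [|m IH] ms /=.
  by rewrite size_poly1 size_poly0 monic1 /psum take0.
have [] := IH (ltnW ms); case: (continuants m) => a b /= sa ma sb.
have a0 : a != 0 by rewrite monic_neq0.
have n0 : (0 < nth 0%N ns m)%N by apply: (allP pos); rewrite mem_nth.
have sXa : size ('X^(nth 0%N ns m) * a) = (psum ns m.+1).+1.
  by rewrite mulrC size_mulXn // sa psumS // addnS addnC.
have lt : (size (- b)%R < size ('X^(nth 0%N ns m) * a)%R)%N.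
  by rewrite size_polyN sXa psumS // ltnS (leq_trans sb) // leq_addr.
split; first by rewrite size_polyDl.
  by rewrite monicE lead_coefDl // lead_coefM lead_coefXn mul1r -monicE.
by rewrite sa psum_ltS.
Qed.

Lemma size_continuant m : (m <= size ns)%N -> size (continuant m) = (psum ns m).+1.
Proof. by case/continuants_size. Qed.

Lemma continuant_bezout m : exists w1 w2,
  w1 * continuant m.+1 + w2 * continuant m = 1.
Proof.
suff [u [v E]] : exists u v, u * (continuants m.+1).1 + v * (continuants m.+1).2 = 1.
  by exists u, v; rewrite -(continuantsS m).
elim: m.+1 => [|{}m [u [v]]] /=; first by exists 1, 0; rewrite mul0r addr0 mulr1.
case: (continuants m) => a b /= E; exists (- v), (u + v * 'X^(nth 0%N ns m)).
by rewrite -[RHS]E; ring.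
Qed.

(** The recurrence is run downwards from c + 1, carrying two consecutive continuants. The bound on v
    decides in which degree the form of [continuant m] enters the ideal. *)
Lemma continuant_comb m c : size ns = c.+1 -> (m <= c)%N -> exists u v : {poly K},
  continuant m = u * continuant c.+1 + v * continuant c /\
  (size v + psum ns m.+1 <= (psum ns c.+1).+1)%N.
Proof.
move=> sns mc.
suff [u [v [u' [v' [E sv E' sv']]]]] : exists u v u' v' : {poly K},
  [/\ continuant m = u * continuant c.+1 + v * continuant c,
      (size v + psum ns m.+1 <= (psum ns c.+1).+1)%N,
      continuant m.+1 = u' * continuant c.+1 + v' * continuant c
    & (size v' + psum ns m.+1 <= psum ns c.+1)%N].
  by exists u, v.
rewrite -(subKn mc); elim: (c - m)%N (leq_subr m c) => [|i IH] ic.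
  exists 0, 1, 1, 0; rewrite subn0 size_poly1 size_poly0.
  by split=> //; rewrite ?mul0r ?mul1r ?add0r ?addr0.
have [u [v [u' [v' [E sv E' sv']]]]] := IH (ltnW ic).
set r := (c - i.+1)%N; have rE : (c - i = r.+1)%N by rewrite /r subnSK.
rewrite rE in E sv E' sv'.
have rs : (r.+1 < size ns)%N by rewrite sns -rE ltnS leq_subr.
have lt := psum_ltS rs.
exists ('X^(nth 0%N ns r.+1) * u - u'), ('X^(nth 0%N ns r.+1) * v - v'), u, v; split=> //.
- have -> : continuant r = 'X^(nth 0%N ns r.+1) * continuant r.+1 - continuant r.+2.
    by rewrite continuantSS opprB addrC subrK.
  by rewrite E E'; ring.
- have sD : (size ('X^(nth 0%N ns r.+1) * v - v')%R <=
      maxn (nth 0%N ns r.+1 + size v) (size v'))%N.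
    apply: (leq_trans (size_polyD _ _)); rewrite size_polyN geq_max leq_maxr andbT.
    apply: leq_trans (leq_maxl _ _).
    have [->|v0] := eqVneq v 0; first by rewrite mulr0 size_poly0.
    by rewrite mulrC size_mulXn.
  rewrite -(leq_add2r (psum ns r.+1)) in sD; apply: (leq_trans sD).
  have := psumS rs; move: sv sv' lt.
  by move: (size v) (size v') => x y; lia.
- by move: sv lt; lia.
Qed.

End Continuants.

(** * Realization of compositions *)

Section Realization.
Variable K : fieldType.
Hypothesis char0 : [pchar K] =i pred0.
Local Notation R := {mpoly K[2]}.

Lemma jordan_type_rows_eq (I : R -> Prop) j (phi : {scalar R}) (l m : R) h P :
  dual_functional I j phi -> coordinates l m h -> jordan_type I l P ->
  P = rows j phi l m.
Proof.
move=> dI lmh jP; apply: (jordan_type_unique (dual_subspace dI) _ jP).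
  by move=> g p; apply: (dual_idealM dI).
exact: (jordan_type_rows dI lmh).
Qed.

Lemma jordan_type_symmetric (I : R -> Prop) j (phi : {scalar R}) (l : R) P :
  dual_functional I j phi -> linear_form l -> jordan_type I l P ->
  symmetric_partition j P.
Proof.
move=> dI /coordinates_exist[m [h lmh]] /(jordan_type_rows_eq dI lmh) ->.
exact: rows_symmetric.
Qed.

Lemma realizes_symmetric j (F l : R) P :
  realizes j F l P -> symmetric_partition j P.
Proof.
case=> hF _ hl jP.
exact: jordan_type_symmetric (Ann_dual_functional char0 hF) hl jP.
Qed.

Lemma realizes_hess_vanishes d k (F l : R) P i :
  (1 < d)%N -> (0 < k)%N -> has_diag_lengths P d k ->
  realizes (socle_deg d k) F l P -> (i < nactive d k)%N ->
  hess_vanishes F i l <-> ~~ boundary (socle_deg d k) P i.+1.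
Proof.
move=> hd hk TP FP; have symP := realizes_symmetric FP.
have [_ sP] := (has_diag_lengthsP hd hk symP).1 TP.
case: FP => hF _ /coordinates_exist[m [h lmh]] jP; rewrite nactiveE => hi.
have id : (i < d)%N by move: hi; case: ifP; lia.
have PE := jordan_type_rows_eq (Ann_dual_functional char0 hF) lmh jP.
rewrite PE; apply: (hess_vanishes_boundary char0 hF lmh).
  by rewrite /socle_deg; lia.
(* Row r reaches degree i: s(r) is at most d + k - 2, so r + p_r = j + 1 - s(r) >= d > i. *)
move=> r ri; rewrite -nth_rows -PE; have rs : (r < size P)%N by lia.
by have [v [vs E _]] := dual_part symP rs; move: E vs; rewrite /socle_deg; lia.
Qed.

(** Regularity is checked on homogeneous components, where after dehomogenization coprimality gives
    divisibility by f0. As f0 has full degree, the quotient homogenizes back. *)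
Lemma regular_sequence2_coprime (l m : R) h s t (f0 g0 : {poly K}) :
  coordinates l m h -> size f0 = s.+1 -> (size g0 <= t.+1)%N ->
  coprimep f0 g0 -> (0 < s)%N -> (0 < t)%N ->
  regular_sequence2 (hform l m s f0) (hform l m t g0).
Proof.
move=> lmh sf sg cop s0 t0; set f := hform l m s f0; set g := hform l m t g0.
have hf : f \is s.-homog by apply: (hform_homog lmh).
have hg : g \is t.-homog by apply: (hform_homog lmh).
have evf : dehom h f = f0 by rewrite (dehom_hform lmh) ?sf.
have evg : dehom h g = g0 by rewrite (dehom_hform lmh).
have f00 : f0 != 0 by rewrite -size_poly_eq0 sf.
have fN0 : f != 0 by apply: contraNneq f00 => fE; rewrite -evf fE rmorph0.
split.
- by move=> p /eqP; rewrite mulf_eq0 (negbTE fN0) orbF => /eqP.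
- move=> p [q E].
  have comp e : exists q', pihomog mdeg e p = q' * f.
    have hp : pihomog mdeg e p \is e.-homog by apply: pihomogP.
    have := congr1 (pihomog mdeg (e + t)) E.
    rewrite (pihomogM _ _ hg) (pihomogM _ _ hf) leq_addl addnK => /(congr1 (dehom h)).
    rewrite rmorphM /= evg => E'.
    have : f0 %| dehom h (pihomog mdeg e p) * g0.
      rewrite E'; case: ifP => _; last by rewrite rmorph0 dvdp0.
      by rewrite rmorphM /= evf dvdp_mull.
    rewrite Gauss_dvdpl // => /divpK pE.
    exists (hform l m (e - s) (dehom h (pihomog mdeg e p) %/ f0)).
    rewrite -[LHS](hform_dehom lmh hp) -[in LHS]pE (@hformM_sub _ _ _ _ lmh s) ?sf //.
    by rewrite size_divp // sf /= leq_sub2r // (size_dehom lmh).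
  rewrite (homog_sumE p); apply: (big_ind (fun x => exists q', x = q' * f)).
  + by exists 0; rewrite mul0r.
  + by move=> _ _ [u ->] [v ->]; exists (u + v); rewrite mulrDl.
  + by move=> e _; apply: comp.
- case=> u [v /(congr1 (mcoeff 0%MM))]; rewrite mcoeffD !mcoeff0_mul.
  rewrite (homog_coef0 hf s0) (homog_coef0 hg t0) !mulr0 addr0 mcoeff1 eqxx => /eqP.
  by rewrite oner_eq0.
Qed.

Lemma realize_blocks j ns c : size ns = c.+1 -> all (fun n => 0 < n)%N ns ->
  (psum ns c + sumn ns <= j.+1)%N ->
  exists (F l : R) (P : seq nat),
    [/\ realizes j F l P, symmetric_partition j P, size P = sumn ns
      & forall b, (0 < b <= size P)%N -> boundary j P b = (b \in scanl addn 0%N ns)].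
Proof.
move=> sns pos le.
have lX := linear_formX K; have [m [h lmh]] := coordinates_exist lX.
set l := 'X_ord0 in lX lmh.
have sE : sumn ns = psum ns c.+1 by rewrite /psum -sns take_size.
(* The degrees of the generators are chosen with s + t - 2 = j. The hypothesis makes t larger than
   the degree of g0, so the second generator is a multiple of l. *)
pose s := sumn ns; pose t := (j.+2 - s)%N.
pose f0 : {poly K} := continuant K ns c.+1; pose g0 : {poly K} := continuant K ns c.
have sf : size f0 = s.+1 by rewrite size_continuant ?sns // /s sE.
have sgE : size g0 = (psum ns c).+1 by rewrite size_continuant ?sns.
have sg : (size g0 <= t.+1)%N by rewrite sgE /t /s; lia.
have cs : (psum ns c < s)%N by rewrite /s sE psum_ltS // sns.
have s0 : (0 < s)%N by apply: leq_ltn_trans cs.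
have t0 : (psum ns c < t)%N by rewrite /t /s; lia.
have [w1 [w2 bez]] := continuant_bezout K ns c.
have t0' : (0 < t)%N by apply: leq_ltn_trans t0.
have jE : (s + t - 2 = j)%N by rewrite /t /s; move: le; lia.
have dI := ci_dual_functional lmh sf sg bez s0 t0'; rewrite jE in dI.
set f := hform l m s f0 in dI; set g := hform l m t g0 in dI.
set phi := (X in dual_functional _ _ X) in dI.
have [F hF FE] := dual_functional_Ann char0 dI.
have dF := dual_functional_ext FE dI.
have jt := jordan_type_rows dF lmh.
(* In degree r < s the ideal contains only multiples of g, whose dehomogenizations have degree at
   most r - t + deg g0 < r. So it contains no form monic in m. *)
have short r : (r < s)%N -> (0 < row_length j phi l m r)%N.
  move=> rs; rewrite lt0n; apply/eqP => p0.
  have := dual_hform_row dI lmh (leqnn r); rewrite p0 => /(_ isT).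
  have sr := size_row_poly j phi l m r.
  case/(ideal2_hform_decomp lmh sf sg) => [|u [v [E su sv]]]; first by rewrite sr.
  have u0 : u = 0 by apply/eqP; rewrite -size_poly_leq0; move: su rs; lia.
  move: sr; rewrite E u0 mul0r add0r => sr.
  have v0 : v != 0 by apply/eqP => v0; rewrite v0 mul0r size_poly0 in sr.
  have := size_polyMleq v g0; rewrite sr sgE; rewrite -size_poly_gt0 in v0.
  by move: sv v0 t0; move: (size v) => x; lia.
have rc : row_count j phi l m = s.
  apply/eqP; rewrite eqn_leq leqNgt ltn_row_count -leqNgt -ltnS.
  have -> /= : (row_length j phi l m s < 1)%N.
    rewrite ltnS -(subnn s); apply: (row_length_hform dI lmh sf) => //.
    by exists 1, 0; rewrite mul1r mul0r addr0.
  by have := short s.-1; rewrite -ltn_row_count prednK // => /(_ (leqnn _)).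
have symP := rows_symmetric j phi l m.
have sP : size (rows j phi l m) = sumn ns by rewrite size_rows rc.
exists F, l, (rows j phi l m); split=> //.
- split=> //; split.
    by case: jt => _ [z [bz _]]; apply: (basis_mod_artinian bz).
  exists s, t, f, g; split=> //; try exact: (hform_homog lmh).
  apply: (regular_sequence2_coprime lmh sf sg _ s0 t0').
  by apply/Bezout_eq1_coprimepP; exists (w1, w2).
(* The continuant of index i has degree [psum ns i], and its form of degree j + 2 - [psum ns i.+1]
   lies in the ideal. This bounds the first row of each block. *)
- apply: (boundary_of_short_rows symP pos) => // i; rewrite sns => ic.
  have [u [v [E sv]]] := continuant_comb K pos sns ic.
  have lei : (psum ns i.+1 <= s)%N.
    by rewrite /s -{2}(cat_take_drop i.+1 ns) sumn_cat leq_addr.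
  have lei' : (psum ns i <= psum ns c)%N.
    by rewrite /psum -(subnKC (ic : (i <= c)%N)) takeD sumn_cat leq_addr.
  have si := size_continuant K pos (ltnW (_ : i < size ns)%N); rewrite sns in si.
  have {}si := si ic.
  have := @row_length_hform _ _ _ _ dI _ _ _ lmh (j.+2 - psum ns i.+1)%N _ _ si.
  rewrite nth_rows => H; have {}H := H _ _.
  suff : (row_length j phi l m (psum ns i) <= j.+2 - psum ns i.+1 - psum ns i)%N.
    by move: lei lei' le; rewrite -/s; lia.
  apply: H; first by move: lei lei' le; rewrite -/s; lia.
  have sie : (size (continuant K ns i) <= (j.+2 - psum ns i.+1).+1)%N.
    by rewrite si; move: lei lei' le; rewrite -/s; lia.
  apply/(ideal2_hform lmh sf sg bez s0 t0' sie).
  rewrite E -/f0 -/g0 (quotient_mod_comb bez) (leq_trans (leq_modp _ _)) //.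
  by move: sv le lei; rewrite -sE -/s /t; move: (size v) (psum ns c) => x y; lia.
Qed.

End Realization.

Local Close Scope ring_scope.

(** * The correspondence with sets of active Hessians *)

Section Correspondence.
Variables (K : fieldType) (d k : nat).
Hypotheses (char0 : [pchar K]%R =i pred0) (hd : 1 < d) (hk : 0 < k).
Local Notation j := (socle_deg d k).

(** The complete intersection comes with some socle degree; the diagonal lengths force it to be
    j. *)
Lemma CIJT_symmetric P : CIJT K d k P -> symmetric_partition j P.
Proof.
case=> _ TP [I [l [/graded_artinian_ci_dual[j' [phi dI]] hl jP]]].
have symP := jordan_type_symmetric dI hl jP.
by have [<- _] := (has_diag_lengthsP hd hk symP).1 TP.
Qed.

Lemma realize_active_boundaries (D : pred nat) :
  exists (F l : {mpoly K[2]}) (P : seq nat),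
    [/\ realizes j F l P, symmetric_partition j P, has_diag_lengths P d k
      & forall i, i < nactive d k -> boundary j P i.+1 = D i.+1].
Proof.
(* [D0] is D cut down to the active range, s is the resulting number of parts, and [D1] adds the
   final boundary s. *)
pose D0 b := (0 < b <= nactive d k) && D b.
pose s := if D0 d then d else d + k - 1.
pose D1 b := D0 b || (b == s).
have s0 : 0 < s by rewrite /s; case: ifP; lia.
have D1s : D1 s by rewrite /D1 eqxx orbT.
have [ns [pos /= sE HD]] := composition_of_pred (leq0n s) D1s.
have [c sns] : exists c, size ns = c.+1.
  by exists (size ns).-1; rewrite prednK //; case: (ns) sE => //=; lia.
have cs : psum ns c < s.
  have := psum_ltS pos (m := c); rewrite sns => /(_ (leqnn _)).
  by rewrite [psum ns c.+1]/psum -sns take_size; lia.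
(* The last boundary before s is active and differs from d, as d in [D0] means s = d. So it is at
   most d - 1, and s <= d + k - 1. *)
have le : psum ns c + sumn ns <= j.+1.
  have [c0|c0] := posnP (psum ns c).
    by rewrite c0 /s /socle_deg in sE *; move: sE; case: ifP; lia.
  have D1c : D1 (psum ns c).
    rewrite HD ?c0 ?(ltnW cs) //; apply/mem_scanl_addn; exists c => //.
    rewrite sns leqnSn andbT lt0n; apply/eqP => cE.
    by move: c0; rewrite cE /psum take0.
  move: D1c; rewrite /D1 (_ : psum ns c == s = false) ?orbF => [D0c|]; last by lia.
  have [bc _] := andP D0c; move: cs bc sE; rewrite nactiveE /s /socle_deg.
  case D0d : (D0 d); first by case: ifP; lia.
  have : psum ns c != d by apply: contraTneq D0c => ->; rewrite D0d.
  by case: ifP; lia.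
have [F [l [P [FP symP sP bdP]]]] := realize_blocks char0 sns pos le.
have sPE : size P = s by lia.
exists F, l, P; split=> //.
  by apply/(has_diag_lengthsP hd hk symP); split=> //; rewrite sPE /s; case: ifP; [left|right].
move=> i hi; have is_ : i.+1 <= s by move: hi; rewrite /s nactiveE; do 2!case: ifP; lia.
rewrite bdP ?sPE // -HD // /D1 /D0 hi /=.
(* The added boundary s is active only if s = d, and then d satisfies D already. *)
case: eqP => [E|]; last by rewrite orbF.
rewrite orbT; move: E hi; rewrite /s nactiveE; case D0d : (D0 d).
  by move=> -> _; case/andP: D0d.
by case: ifP; lia.
Qed.

End Correspondence.

Theorem theorem3p8 (K : fieldType) (hchar : [pchar K]%R =i pred0)
    (d k : nat) (hd : 2 <= d) (hk : 1 <= k) :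
  (exists Phi : seq nat -> {set 'I_(nactive d k)},
     [/\ forall (P : seq nat) (F l : {mpoly K[2]}),
           has_diag_lengths P d k -> realizes (socle_deg d k) F l P ->
           forall i : 'I_(nactive d k), i \in Phi P <-> hess_vanishes F i l,
         forall P Q : seq nat,
           CIJT K d k P -> CIJT K d k Q -> Phi P = Phi Q -> P = Q
       & forall S : {set 'I_(nactive d k)},
           exists2 P : seq nat, CIJT K d k P & Phi P = S])
  /\ #|{: {set 'I_(nactive d k)}}| = (if 1 < k then 2 ^ d else 2 ^ (d - 1))
  /\ (forall (P : seq nat) (n : nat) (ns : seq nat),
        is_partition P -> has_diag_lengths P d k ->
        n <= (if 2 <= k then d else d - 1) ->
        all (fun m => 0 < m) ns -> sumn ns = n ->
        ((exists F l : {mpoly K[2]},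
            [/\ realizes (socle_deg d k) F l P,
                forall i, 1 <= i <= size ns ->
                  ~ hess_vanishes F (psum ns i - 1) l
              & forall t, t < nactive d k ->
                  (forall i, 1 <= i <= size ns -> t <> psum ns i - 1) ->
                  hess_vanishes F t l])
         <-> P = hess_partition d k ns)).
Proof.
set j := socle_deg d k.
split; [|split].
- exists (fun P => [set i : 'I_(nactive d k) | ~~ boundary j P i.+1]); split.
  + move=> P F l TP FP i; rewrite inE.
    exact: iff_sym (realizes_hess_vanishes hchar hd hk TP FP (ltn_ord i)).
  + move=> P Q cP cQ /setP E.
    apply: (active_boundaries_eq hd hk (CIJT_symmetric hd hk cP) _ (CIJT_symmetric hd hk cQ)).
    * by case: cP.
    * by case: cQ.
    by move=> i hi; have := E (Ordinal hi); rewrite !inE /=; apply: negb_inj.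
  + move=> S.
    (* The number i + 1 is to be a boundary exactly when i is outside S. *)
    pose D b := [forall i : 'I_(nactive d k), (i.+1 == b) ==> (i \notin S)].
    have [F [l [P [FP symP TP bdP]]]] := realize_active_boundaries hchar hd hk D.
    exists P.
      case: (FP) => _ ciF hl jP; split=> //; first by case: jP.
      by exists (Ann F), l.
    apply/setP => i; rewrite inE bdP // /D; apply/idP/idP.
      by case/forallPn => i' ; rewrite negb_imply negbK eqSS => /andP[/eqP/val_inj ->].
    by move=> iS; apply/forallPn; exists i; rewrite eqxx iS.
- by rewrite -cardsT -powersetT card_powerset cardsT card_ord nactiveE; case: ifP.
move=> P n ns partP TP; rewrite -nactiveE => nle pos sE.
have pse i : psum ns i <= nactive d k.
  by apply: leq_trans nle; rewrite -sE /psum -{2}(cat_take_drop i ns) sumn_cat leq_addr.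
have ps0 i : 1 <= i <= size ns -> 0 < psum ns i.
  case: i => // i; rewrite ltnS => hi; apply: leq_ltn_trans (psum_ltS pos _); lia.
have act i : 1 <= i <= size ns -> psum ns i - 1 < nactive d k.
  by move=> hi; have := pse i; have := ps0 i hi; lia.
have subK i : 1 <= i <= size ns -> (psum ns i - 1).+1 = psum ns i.
  by move=> hi; have := ps0 i hi; lia.
rewrite -sE in nle; split=> [[F [l [FP nz z]]]|->].
  have symP := realizes_symmetric hchar FP.
  apply: hess_partition_of_boundaries => // [i hi|t ht tn].
    apply: contraT => nb; case: (nz i hi); rewrite -subK // in nb.
    exact/(realizes_hess_vanishes hchar hd hk TP FP (act i hi)).
  exact/(realizes_hess_vanishes hchar hd hk TP FP ht)/z.
(* For (i) from (ii), an algebra is realized whose active boundaries are the partial sums of [ns];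
   its Jordan type Q is then the given partition. *)
have [F [l [Q [FQ symQ TQ bdQ]]]] :=
  realize_active_boundaries hchar hd hk (fun b => b \in scanl addn 0 ns).
have bd i : 1 <= i <= size ns -> boundary j Q (psum ns i).
  move=> hi; rewrite -subK // bdQ ?act // subK //.
  by apply/mem_scanl_addn; exists i.
have nbd t : t < nactive d k -> (forall i, 1 <= i <= size ns -> t <> psum ns i - 1) ->
    ~~ boundary j Q t.+1.
  move=> ht tn; rewrite bdQ //; apply/negP => /mem_scanl_addn[i hi E].
  by apply: (tn i hi); rewrite /psum; lia.
rewrite -(hess_partition_of_boundaries hd hk symQ TQ pos nle bd nbd).
exists F, l; split=> // [i hi|t ht tn].
  by move/(realizes_hess_vanishes hchar hd hk TQ FQ (act i hi)); rewrite subK // bd.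
exact/(realizes_hess_vanishes hchar hd hk TQ FQ ht)/nbd.
Qed.
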